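(* Let $S\subset\mathbb{R}$ be a measurable set and suppose that $|S_a|<a$ for some $a>0$, where $S_a:=(S+a\mathbb{Z})\cap[0,a]$ and $|\cdot|$ denotes Lebesgue measure. Then there is a uniformly discrete set $\Lambda\subset\mathbb{R}$ with uniform density $D(\Lambda)=a$ which is a uniqueness set for $Y_S$.
   Context: Fourier transform: $\hat f(t)=\int_{\mathbb{R}} e^{-2\pi i t x}f(x)\,dx$. $Y$ is the space of continuous functions $f$ on $\mathbb{R}$ with $\sup_{x\in\mathbb{R}}(1+x^2)|f(x)|<\infty$; $Y_S$ is the subspace of those $f\in Y$ with $\hat f=0$ outside $S$. A set $\Lambda\subset\mathbb{R}$ is uniformly discrete if $\inf\{|\lambda-\lambda'|:\lambda,\lambda'\in\Lambda,\lambda\neq\lambda'\}>0$. It has uniform density $D(\Lambda)$ if $\mathrm{Card}(\Lambda\cap(x,x+r))=rD(\Lambda)+o(r)$ uniformly in $x$ as $r\to\infty$. A set $\Lambda$ is a uniqueness set for a space of continuous functions if the only function in the space vanishing on $\Lambda$ is the zero function. *)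

(* Defs.v *)
From mathcomp Require Import all_boot all_order all_algebra.
From mathcomp Require Import all_classical all_reals all_analysis.
Import Order.TTheory GRing.Theory Num.Theory.
Import numFieldNormedType.Exports.
Set Implicit Arguments. Unset Strict Implicit. Unset Printing Implicit Defensive.
Local Open Scope classical_set_scope. Local Open Scope ring_scope.

(* The carrier type of the (completed) Lebesgue measure on R, whose
   measurable sets are exactly the Lebesgue measurable sets. *)
Definition lebesgueType (R : realType) :=
  caratheodory_type (R:=R) (wlength (R:=R) idfun)^*%mu.

Definition lebesgue_measurable (R : realType) (S : set R) : Prop :=
  @measurable _ (lebesgueType R) S.

Definition leb (R : realType) (A : set R) : \bar R :=
  @completed_lebesgue_measure R A.

Definition Sa (R : realType) (S : set R) (a : R) : set R :=
  [set x | (exists k : int, S (x - k%:~R * a)) /\ 0 <= x <= a].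

(* A complex-valued function on R is represented by its real part u and
   imaginary part v : f = u + i v. *)

Definition inY (R : realType) (u v : R -> R) : Prop :=
  continuous u /\ continuous v /\
  exists C : R, forall x : R, (1 + x ^+ 2) * Num.sqrt (u x ^+ 2 + v x ^+ 2) <= C.

(* Real and imaginary parts of the Fourier transform
   \hat f(t) = \int e^{-2 pi i t x} f(x) dx, with f = u + i v:
   e^{-i th}(u + i v) = (u cos th + v sin th) + i (v cos th - u sin th). *)
Definition fourier_re (R : realType) (u v : R -> R) (t : R) : R :=
  Rintegral (@lebesgue_measure R) setT
    (fun x => u x * cos (2 * pi * t * x) + v x * sin (2 * pi * t * x)).

Definition fourier_im (R : realType) (u v : R -> R) (t : R) : R :=
  Rintegral (@lebesgue_measure R) setT
    (fun x => v x * cos (2 * pi * t * x) - u x * sin (2 * pi * t * x)).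

Definition inYS (R : realType) (S : set R) (u v : R -> R) : Prop :=
  inY u v /\ forall t, ~ S t -> fourier_re u v t = 0 /\ fourier_im u v t = 0.

Definition uniformly_discrete (R : realType) (L : set R) : Prop :=
  exists delta : R, 0 < delta /\
    forall l l', L l -> L l' -> l != l' -> delta <= `|l - l'|.

Definition has_uniform_density (R : realType) (L : set R) (D : R) : Prop :=
  forall eps : R, 0 < eps -> exists r0 : R, 0 < r0 /\
    forall r x : R, r0 <= r ->
      exists s : seq R, uniq s /\ [set` s] = L `&` [set y | x < y < x + r] /\
        `|(size s)%:R - r * D| <= eps * r.

Definition uniqueness_set_YS (R : realType) (S : set R) (L : set R) : Prop :=
  forall u v : R -> R, inYS S u v -> (forall l, L l -> u l = 0 /\ v l = 0) ->
    forall x, u x = 0 /\ v x = 0.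

(* Main.v *)
Require Import Defs.
From HB Require Import structures.
From mathcomp Require Import all_boot all_order all_algebra.
From mathcomp Require Import all_classical all_reals all_analysis measurable_realfun.
From mathcomp Require Import ring lra zify.
Import Order.TTheory GRing.Theory Num.Theory.
Import numFieldNormedType.Exports.
From mathcomp Require Import complex.
Import ComplexField.Normc.
Set Implicit Arguments. Unset Strict Implicit. Unset Printing Implicit Defensive.
Local Open Scope classical_set_scope. Local Open Scope ring_scope.

(**
Write [e(x) = exp(2 pi i x)].  Since the outer measure of [S_a] is less than [a], there
is a compact [K] in [[0, a]] of positive measure which misses [S + aZ].  If [f] is in
[Y_S] and [t] is in [K], then the [1/a]-periodization of [f(x) e(-tx)] is continuous and
all its Fourier coefficients [fhat(t + ka)] vanish, so for every [x] the absolutely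
convergent series [sum_n f(x + n/a) e(-nt/a)] is zero on [K].

Suppose that [f(x + n/a) = 0] for [p <= n < q].  Then the part [n < p] of that series,
which is a power series in [e(t/a)] up to a unimodular factor, is [O(1/q)] on [K], because
[f(y) = O(1/y^2)].  A bounded power series that is very small on a set of positive measure
has small coefficients: pair it with [exp (l (A - A(0)))], where [Re A] approximates the
indicator function of [K] and [l] is large; this function takes the value [1] at the
origin and is small outside [K].  So if [q] is large enough compared with [p], all the
values [f(x + n/a)] with [|n| <= 2p], say, are small.

The set is [{n/a + s_n}], where [s_n] is constant, equal to [h_m], for [p_m <= n < p_(m+1)],
with [(p_m)] growing fast.  The shifts [h_m = (1 + 1/2 + ... + 1/m)/a] have steps tending
to [0], so the density is [a], and they accumulate modulo [1/a] at every point; hence [f]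
is zero by continuity.
*)

(** * Complex exponentials *)

Section ComplexNorm.
Context {R : realType}.
Implicit Types z w : R[i].

Lemma normc_ge0 z : 0 <= normc z.
Proof. by case: z => a b; exact: sqrtr_ge0. Qed.

Lemma sqr_normcE z : normc z ^+ 2 = Re z ^+ 2 + Im z ^+ 2.
Proof. by case: z => a b /=; rewrite sqr_sqrtr// addr_ge0 ?sqr_ge0. Qed.

Lemma ReCD z w : Re (z + w) = Re z + Re w. Proof. by case: z w => ? ? []. Qed.
Lemma ImCD z w : Im (z + w) = Im z + Im w. Proof. by case: z w => ? ? []. Qed.
Lemma ReCB z w : Re (z - w) = Re z - Re w. Proof. by case: z w => ? ? []. Qed.
Lemma ReCM z w : Re (z * w) = Re z * Re w - Im z * Im w.
Proof. by case: z w => ? ? []. Qed.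
Lemma ImCM z w : Im (z * w) = Re z * Im w + Im z * Re w.
Proof. by case: z w => ? ? []. Qed.

Lemma Re_sum I (r : seq I) (P : pred I) (F : I -> R[i]) :
  Re (\sum_(i <- r | P i) F i) = \sum_(i <- r | P i) Re (F i).
Proof. by apply: (big_morph (@Re R) ReCD). Qed.

Lemma Im_sum I (r : seq I) (P : pred I) (F : I -> R[i]) :
  Im (\sum_(i <- r | P i) F i) = \sum_(i <- r | P i) Im (F i).
Proof. by apply: (big_morph (@Im R) ImCD). Qed.

Lemma normc_Re z : `|Re z| <= normc z.
Proof.
rewrite -[leLHS]sqrtr_sqr; case: z => a b /=.
by rewrite ler_wsqrtr// lerDl sqr_ge0.
Qed.

Lemma normc_Im z : `|Im z| <= normc z.
Proof.
rewrite -[leLHS]sqrtr_sqr; case: z => a b /=.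
by rewrite ler_wsqrtr// lerDr sqr_ge0.
Qed.

Lemma Re_le_normc z : Re z <= normc z.
Proof. exact: le_trans (ler_norm _) (normc_Re z). Qed.

Lemma normc_real (x : R) : normc (x%:C)%C = `|x|.
Proof. by rewrite /= expr0n/= addr0 sqrtr_sqr. Qed.

Lemma normcX z n : normc (z ^+ n) = normc z ^+ n.
Proof. by elim: n => [|n IH]; rewrite ?expr0 ?normc1// !exprS normcM IH. Qed.

Lemma normc_sum I (r : seq I) (P : pred I) (F : I -> R[i]) :
  normc (\sum_(i <- r | P i) F i) <= \sum_(i <- r | P i) normc (F i).
Proof.
elim/big_rec2: _ => [|i x y _ le]; first by rewrite normc0.
by apply: le_trans (le_normcD _ _) _; rewrite lerD2l.
Qed.

(** Take the conjugate of [z] divided by its modulus. Since [Rintegral] is real valued, every bound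
    on the modulus of a complex sum or coefficient is reduced in this way to a bound on one real
    part. *)
Lemma normc_phase z : exists2 c : R[i], normc c = 1 & Re (c * z) = normc z.
Proof.
have [->|z0] := eqVneq z 0.
  by exists 1; [exact: normc1|rewrite mulr0 normc0].
have nz : normc z != 0 by apply: contra z0 => /eqP/eq0_normc ->.
exists ((Re z / normc z) +i* (- (Im z / normc z)))%C => /=.
  rewrite sqrrN !expr_div_n -mulrDl -sqr_normcE divff ?sqrtr1//.
  by rewrite expf_neq0.
rewrite ReCM /= mulNr opprK !(mulrAC _ _^-1) -mulrDl -!expr2 -sqr_normcE.
by rewrite expr2 mulfK.
Qed.

End ComplexNorm.

(* Locked, since otherwise simplification exposes [cos] and [sin]. *)
HB.lock Definition cis (R : realType) (x : R) : R[i] :=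
  (cos (2 * pi * x) +i* sin (2 * pi * x))%C.
Arguments cis {R} x.

Section Cis.
Context {R : realType}.
Implicit Types x y : R.

Lemma cisE x : cis x = (cos (2 * pi * x) +i* sin (2 * pi * x))%C.
Proof. by rewrite unlock. Qed.

Lemma Re_cis x : Re (cis x) = cos (2 * pi * x). Proof. by rewrite cisE. Qed.
Lemma Im_cis x : Im (cis x) = sin (2 * pi * x). Proof. by rewrite cisE. Qed.

Lemma cisD x y : cis (x + y) = cis x * cis y.
Proof.
rewrite !cisE mulrDr cosD sinD.
by rewrite -[RHS]/((_ - _) +i* (_ + _))%C; congr (_ +i* _)%C; ring.
Qed.

Lemma cis0 : cis (0 : R) = 1.
Proof. by rewrite !cisE mulr0 cos0 sin0. Qed.

Lemma normc_cis x : normc (cis x) = 1.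
Proof. by rewrite cisE /= cos2Dsin2 sqrtr1. Qed.

Lemma cis_nat n : cis (n%:R : R) = 1.
Proof.
rewrite !cisE.
have -> : 2 * pi * n%:R = 0 + (pi *+ 2) *+ n :> R.
  by ring.
rewrite (periodicn (@cosD2pi R)) (periodicn (@sinD2pi R)).
by rewrite cos0 sin0.
Qed.

Lemma cisN x : cis (- x) = (cis x)^*%C.
Proof. by rewrite !cisE mulrN cosN sinN. Qed.

Lemma cis_int (m : int) : cis (m%:~R : R) = 1.
Proof.
case: m => n; first exact: cis_nat.
rewrite NegzE mulrNz cisN -pmulrn cis_nat.
by apply/eqP; rewrite eq_complex /= oppr0 !eqxx.
Qed.

Lemma cisMn x n : cis (n%:R * x) = cis x ^+ n.
Proof.
elim: n => [|n IH]; first by rewrite mul0r cis0.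
by rewrite exprS -IH -cisD; congr cis; rewrite -natr1; ring.
Qed.

(** The chord [normc (1 - cis x)] serves throughout as the distance from [x] to the nearest integer;
    unlike that distance it is the modulus of a trigonometric polynomial. *)
Lemma chordE x : normc (1 - cis x) ^+ 2 = 2 - 2 * cos (2 * pi * x).
Proof.
rewrite sqr_normcE cisE /=.
have := cos2Dsin2 (2 * pi * x); rewrite sub0r sqrrN => H.
rewrite sqrrB expr1n mul1r -addrA H -mulr_natl; ring.
Qed.

Lemma chord_le2 x : normc (1 - cis x) <= 2.
Proof.
by rewrite (le_trans (le_normcD _ _))// normcN normc_cis normc1 -natr1.
Qed.

(** The cosine decreases on [[0, pi]], so the chord grows with [|x|] up to half a period. *)
Lemma chord_lb x (r : R) : 0 < r -> r <= `|x| <= 2^-1 ->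
  2 - 2 * cos (2 * pi * r) <= normc (1 - cis x) ^+ 2.
Proof.
move=> r0 /andP[rx x2]; rewrite chordE.
have -> : cos (2 * pi * x) = cos (2 * pi * `|x|).
  by rewrite -cos_norm !normrM (ger0_norm (pi_ge0 R)) (@ger0_norm _ 2).
rewrite lerD2l lerN2 ler_pM2l//.
move: rx; rewrite le_eqVlt => /predU1P[->//|rx].
have p0 := pi_gt0 R.
have h (t : R) : 0 < t -> t <= 2^-1 -> 2 * pi * t \in `[0, pi].
  move=> t0 t2; rewrite in_itv/=; apply/andP; split.
    by rewrite !mulr_ge0 ?pi_ge0 ?ltW.
  rewrite mulrAC -[leRHS]mul1r ler_pM2r//; lra.
have x0 : 0 < `|x| by apply: lt_trans rx.
rewrite ltW// ltr_cos ?h//; last by rewrite ltW// (lt_le_trans rx).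
by rewrite ltr_pM2l// mulr_gt0.
Qed.

Lemma chord_lb_gt0 (r : R) : 0 < r -> r <= 2^-1 -> 0 < 2 - 2 * cos (2 * pi * r).
Proof.
move=> r0 r2; have p0 := pi_gt0 R.
suff : cos (2 * pi * r) < cos 0 by rewrite cos0 => ?; lra.
rewrite ltr_cos ?in_itv/=; first by rewrite !mulr_gt0.
- by rewrite lexx ltW.
- apply/andP; split; first by rewrite !mulr_ge0// ltW.
  rewrite mulrAC -[leRHS]mul1r ler_pM2r//; lra.
Qed.

Lemma cis_neq1 x : 0 < `|x| < 1 -> cis x != 1.
Proof.
move=> /andP[x0 x1].
have h (y : R) : 0 < y -> y <= 2^-1 -> cis y != 1.
  move=> y0 y2; apply/eqP => e.
  have := chord_lb_gt0 y0 y2; rewrite -chordE e subrr normc0 expr0n/=.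
  by rewrite ltxx.
have h' (y : R) : 0 < y < 1 -> cis y != 1.
  move=> /andP[y0 y1]; have [y2|y2] := leP y 2^-1; first exact: h.
  (* Beyond half a turn, the reflection [y -> 1 - y], which conjugates [cis y], leads back to the
     first case. *)
  have : cis (1 - y) != 1 by apply: h; lra.
  apply: contra => /eqP e; rewrite cisD -[1]/(1%:R) cis_nat mul1r cisN e.
  by apply/eqP/eqP; rewrite eq_complex /= oppr0 !eqxx.
have [xp|xn] := ger0P x; first by apply: h'; move: x0 x1; rewrite ger0_norm// => -> ->.
have : cis (- x) != 1 by apply: h'; move: x0 x1; rewrite ltr0_norm// => -> ->.
apply: contra => /eqP e; rewrite cisN e.
by rewrite eq_complex /= oppr0 !eqxx.
Qed.

Lemma continuous_lin_cos (c : R) : continuous (fun x => cos (c * x)).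
Proof.
move=> x; apply: continuous_comp; last exact: continuous_cos.
by apply: cvgM; [exact: cvg_cst|exact: cvg_id].
Qed.

Lemma continuous_lin_sin (c : R) : continuous (fun x => sin (c * x)).
Proof.
move=> x; apply: continuous_comp; last exact: continuous_sin.
by apply: cvgM; [exact: cvg_cst|exact: cvg_id].
Qed.

End Cis.

(** * The Fejer kernel *)

Section RealIntegrals.
Context {R : realType}.
Notation mu := (@lebesgue_measure R).

Lemma integrable_continuous_itv (f : R -> R) (c d : R) :
  continuous f -> mu.-integrable `[c, d] (EFin \o f).
Proof.
move=> cf; apply: continuous_compact_integrable; first exact: segment_compact.
exact: continuous_subspaceT.
Qed.

Lemma continuous_bigsum (T : topologicalType) I (r : seq I) (F : I -> T -> R) :
  (forall i, continuous (F i)) -> continuous (fun x => \sum_(i <- r) F i x).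
Proof.
move=> cF x; elim: r => [|i r IH].
  by under eq_fun do rewrite big_nil; exact: cvg_cst.
under eq_fun do rewrite big_cons.
by apply: cvgD => //; exact: cF.
Qed.

Lemma Rintegral_sum (D : set R) I (r : seq I) (F : I -> R -> R) :
  measurable D -> (forall i, mu.-integrable D (EFin \o F i)) ->
  \int[mu]_(x in D) (\sum_(i <- r) F i x) = \sum_(i <- r) \int[mu]_(x in D) F i x.
Proof.
move=> mD iF; elim: r => [|i r IH].
  rewrite big_nil; under eq_Rintegral do rewrite big_nil.
  by rewrite Rintegral_cst// mul0r.
rewrite big_cons -IH; under eq_Rintegral do rewrite big_cons.
rewrite RintegralD//.
have := @integrable_sum _ _ _ mu D mD I r xpredT (fun i => EFin \o F i) (fun i _ => iF i).
by congr (_.-integrable _ _); apply/funext => x /=; rewrite sumEFin.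
Qed.

Lemma lebesgue_itv_len (c d : R) : c <= d -> fine (mu `[c, d]) = d - c.
Proof.
move=> cd; rewrite lebesgue_measure_itv/= lte_fin.
by case: ltP => //= dc; apply/esym/eqP; rewrite subr_eq0 eq_le cd dc.
Qed.

Lemma continuous_Re_cis (b : R[i]) (w y : R) :
  continuous (fun x => Re (b * cis (w * (x - y)))).
Proof.
move=> x; under eq_fun do rewrite ReCM Re_cis Im_cis.
have cl : {for x, continuous (fun x => w * (x - y))}.
  by apply: cvgM; [exact: cvg_cst|apply: cvgB; [exact: cvg_id|exact: cvg_cst]].
apply: cvgB; apply: cvgM; try exact: cvg_cst.
- by apply: continuous_comp; [apply: cvgM; [exact: cvg_cst|exact: cl]|exact: continuous_cos].
- by apply: continuous_comp; [apply: cvgM; [exact: cvg_cst|exact: cl]|exact: continuous_sin].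
Qed.

(** The explicit antiderivative [G] takes the same value at both ends, because [cis (w * P) = 1]
    makes it [P]-periodic. *)
Lemma Rintegral_cis (b : R[i]) (w P c : R) : 0 < P -> w != 0 -> cis (w * P) = 1 ->
  \int[mu]_(x in `[c, c + P]) Re (b * cis (w * x)) = 0.
Proof.
move=> P0 w0 wP.
have pw : 2 * pi * w != 0 by rewrite !mulf_neq0// gt_eqF// pi_gt0.
pose G x := (2 * pi * w)^-1 * (Re b * sin (2 * pi * w * x) + Im b * cos (2 * pi * w * x)).
have dG (x : R) : is_derive x 1 G (Re (b * cis (w * x))).
  rewrite /G ReCM Re_cis Im_cis.
  have dl : is_derive x 1 (fun x : R => 2 * pi * w * x) (2 * pi * w).
    have h := is_deriveZ (2 * pi * w) (is_derive_id x (1 : R)).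
    by apply: (@is_derive_eq _ _ _ _ _ _ _ _ h); rewrite /GRing.scale/= mulr1.
  have ds := is_derive1_comp (is_derive_sin _) dl.
  have dc := is_derive1_comp (is_derive_cos _) dl.
  have d1 := is_deriveZ (Re b) ds; have d2 := is_deriveZ (Im b) dc.
  have h := is_deriveZ (2 * pi * w)^-1 (is_deriveD d1 d2).
  apply: (@is_derive_eq _ _ _ _ _ _ _ _ h); rewrite /GRing.scale/=.
  rewrite !(mulrA _ w x); move: (2 * pi * w) pw => k k0.
  by field.
have cG : continuous G.
  by move=> x; apply/differentiable_continuous/derivable1_diffP; exact: ex_derive.
rewrite /Rintegral (@continuous_FTC2 _ _ G); first last.
- by move=> x _; rewrite derive1E; exact: derive_val.
- split.
  + by move=> x _; exact: ex_derive.
  + exact/cvg_at_right_filter/cG.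
  + exact/cvg_at_left_filter/cG.
- apply: continuous_subspaceT; have := @continuous_Re_cis b w 0.
  by under eq_fun do rewrite subr0.
- by rewrite ltrDl.
rewrite -EFinB/= /G -mulrBr.
have : cis (w * (c + P)) = cis (w * c) by rewrite mulrDr cisD wP mulr1.
by rewrite !cisE !mulrA => -[-> ->]; rewrite subrr mulr0.
Qed.

End RealIntegrals.

Section Fejer.
Context {R : realType}.
Notation mu := (@lebesgue_measure R).

(** This is the sum of [(1 - |k| / n) e(kx)] over [|k| < n], in the form that makes positivity
    evident. *)
Definition fejer n (x : R) : R := normc (\sum_(k < n) cis (k%:R * x)) ^+ 2 / n%:R.

Lemma fejer_ge0 n x : 0 <= fejer n x.
Proof. by rewrite divr_ge0// exprn_ge0// normc_ge0. Qed.

Lemma fejerE n x : fejer n x =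
  n%:R^-1 * \sum_(k < n) \sum_(l < n) Re (cis ((k%:R - l%:R) * x)).
Proof.
rewrite /fejer mulrC; congr (_ * _).
set z := (X in normc X).
have -> : normc z ^+ 2 = Re (z * z^*%C).
  by rewrite sqr_normcE; case: (z) => a b /=; ring.
have -> : z^*%C = \sum_(k < n) cis (- (k%:R * x)).
  rewrite /z (big_morph (@conjc R) (id1 := 0) (op1 := +%R)) //.
  - by apply: eq_bigr => i _; rewrite cisN.
  - by move=> [a b] [c d]; apply/eqP; rewrite eq_complex /= opprD !eqxx.
  - by apply/eqP; rewrite eq_complex /= oppr0 !eqxx.
rewrite mulr_suml Re_sum; apply: eq_bigr => k _.
rewrite mulr_sumr Re_sum; apply: eq_bigr => l _.
by rewrite -cisD; congr (Re (cis _)); ring.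
Qed.

(** The factor [1 - cis x] telescopes the geometric sum to [1 - cis (n%:R * x)], a chord of length
    at most 2. *)
Lemma fejer_chord n x : (0 < n)%N -> normc (1 - cis x) ^+ 2 * fejer n x <= 4 / n%:R.
Proof.
move=> n0; rewrite /fejer mulrA ler_pM2r ?invr_gt0 ?ltr0n//.
rewrite -exprMn -normcM.
under eq_bigr do rewrite cisMn.
have -> : (1 - cis x) * (\sum_(i < n) cis x ^+ i) = 1 - cis (n%:R * x).
  by rewrite cisMn -opprB mulNr -subrX1 opprB.
have -> : 4 = 2 ^+ 2 :> R by ring.
by rewrite lerXn2r ?nnegrE ?normc_ge0// chord_le2.
Qed.

(** In the double sum of [fejerE] only the [n] diagonal terms have a nonzero mean over a period. *)
Lemma fejer_int n (P c y : R) : (0 < n)%N -> 0 < P ->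
  \int[mu]_(x in `[c, c + P]) fejer n (P^-1 * (x - y)) = P.
Proof.
move=> n0 P0; have nP := gt_eqF P0.
have cont (w : R) : continuous (fun x => Re (cis (w * (P^-1 * (x - y))))).
  move=> x; under eq_fun do rewrite mulrA -[cis _]mul1r.
  exact: continuous_Re_cis.
under eq_Rintegral do rewrite fejerE pair_big.
have mI : measurable (`[c, c + P]%classic : set R) by [].
rewrite RintegralZl//; last first.
  apply: integrable_continuous_itv; apply: continuous_bigsum => i.
  exact: cont.
rewrite Rintegral_sum//; last by move=> i; apply: integrable_continuous_itv; exact: cont.
rewrite -(pair_big xpredT xpredT (fun k l : 'I_n =>
  \int[mu]_(x in `[c, c + P]) Re (cis ((k%:R - l%:R) * (P^-1 * (x - y)))))) /=.
rewrite (eq_bigr (fun=> P)); last first.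
  move=> k _; rewrite (bigD1 k)//= subrr big1 ?addr0.
    under eq_Rintegral do rewrite mul0r cis0 /=.
    by rewrite Rintegral_cst// lebesgue_itv_len ?lerDl ?ltW// mul1r addrC addKr.
  move=> l lk; set w := (k%:R - l%:R) / P.
  under eq_Rintegral do rewrite mulrA -/w mulrBr cisD mulrC.
  apply: Rintegral_cis => //.
    rewrite mulf_neq0 ?invr_eq0 ?nP// subr_eq0 eqr_nat.
    by apply: contra lk => /eqP e; apply/eqP/val_inj.
  by rewrite mulfVK ?nP// cisD cisN !cis_nat conjc1 mulr1.
by rewrite sumr_const card_ord -[P *+ n]mulr_natl mulKf// pnatr_eq0 -lt0n.
Qed.

(** Discrete counterpart of [fejer_int]: the off-diagonal frequencies satisfy [0 < |k - l| < n], so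
    they are not multiples of [n] and sum to zero over the [n] equidistant nodes. *)
Lemma fejer_nodes n x : (0 < n)%N ->
  \sum_(j < n) fejer n (x - j%:R / n%:R) = n%:R.
Proof.
move=> n0; have nn : n%:R != 0 :> R by rewrite pnatr_eq0 -lt0n.
under eq_bigr do rewrite fejerE.
rewrite -mulr_sumr exchange_big /=.
rewrite (eq_bigr (fun=> n%:R)); first by rewrite sumr_const card_ord -[n%:R *+ n]mulr_natl mulKf.
move=> k _; rewrite exchange_big /= (bigD1 k)//= [X in _ + X]big1 ?addr0.
  under eq_bigr do rewrite subrr mul0r cis0 /=.
  by rewrite sumr_const card_ord.
move=> l lk; rewrite -Re_sum.
set d : R := k%:R - l%:R.
have -> : \sum_(i < n) cis (d * (x - i%:R / n%:R)) =
   cis (d * x) * \sum_(i < n) cis (- d / n%:R) ^+ i.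
  rewrite mulr_sumr; apply: eq_bigr => i _; rewrite -cisMn -cisD; congr cis.
  by field.
have z1 : cis (- d / n%:R) != 1.
  apply: cis_neq1; rewrite normrM normrN normfV (@ger0_norm _ n%:R)//.
  rewrite divr_gt0 ?ltr0n//=; last first.
    rewrite normr_gt0 subr_eq0 eqr_nat.
    by apply: contra lk => /eqP e; apply/eqP/val_inj.
  rewrite ltr_pdivrMr ?ltr0n// mul1r.
  have := ltn_ord k; have := ltn_ord l; rewrite -!(ltr_nat R) => hl hk.
  have := ler0n R k; have := ler0n R l => l0 k0.
  by rewrite ltr_norml /d; lra.
suff -> : \sum_(i < n) cis (- d / n%:R) ^+ i = 0 by rewrite mulr0.
move/eqP: (subrX1 (cis (- d / n%:R)) n); rewrite -cisMn mulrC mulfVK//.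
have -> : cis (- d) = 1 by rewrite /d opprB cisD cisN !cis_nat conjc1 mulr1.
by rewrite subrr eq_sym mulf_eq0 subr_eq0 (negbTE z1) => /eqP.
Qed.

Lemma fejer_le n x : fejer n x <= n%:R.
Proof.
case: n => [|n]; first by rewrite /fejer invr0 mulr0.
rewrite ler_pdivrMr ?ltr0n// -expr2 lerXn2r ?nnegrE ?normc_ge0//.
apply: le_trans (normc_sum _ _ _) _.
by under eq_bigr do rewrite normc_cis; rewrite sumr_const card_ord.
Qed.

Lemma continuous_fejer n (w y : R) : continuous (fun x => fejer n (w * (x - y))).
Proof.
move=> x; under eq_fun do rewrite fejerE.
apply: cvgM; first exact: cvg_cst.
move: x; apply: continuous_bigsum => k; apply: continuous_bigsum => l x.
under eq_fun do rewrite mulrA -[cis _]mul1r.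
exact: continuous_Re_cis.
Qed.

End Fejer.

(** * Integrals on the line *)

Section IntegralsOnTheLine.
Context {R : realType}.
Notation mu := (@lebesgue_measure R).

(** By evenness the integral is twice the arctangent integral over the half-line. *)
Lemma integrable_oneDsqrV : mu.-integrable setT (fun x : R => ((1 + x ^+ 2)^-1)%:E).
Proof.
apply/integrableP; split.
  apply/measurable_EFinP; apply: continuous_measurable_fun.
  exact: continuous_oneDsqrV.
have e : (\int[mu]_x `|((1 + x ^+ 2)^-1)%:E| = \int[mu]_x ((oneDsqr x)^-1)%:E)%E.
  by apply: eq_integral => x _ /=; rewrite ger0_norm// invr_ge0 addr_ge0// sqr_ge0.
rewrite e ge0_symfun_integralT//.
- have -> : [set x : R | 0 <= x] = `[0, +oo[%classic.
    by apply/seteqP; split => x /=; rewrite in_itv/= andbT.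
  by rewrite integral0y_oneDsqr -EFinM ltry.
- exact: continuous_oneDsqrV.
- by move=> x /=; rewrite /oneDsqr sqrrN.
Qed.

Lemma integrable_decay (h : R -> R) (C : R) : continuous h ->
  (forall x, `|h x| <= C / (1 + x ^+ 2)) -> mu.-integrable setT (EFin \o h).
Proof.
move=> ch hC.
apply: (@le_integrable _ _ _ mu setT measurableT _
  (fun x : R => C%:E * ((1 + x ^+ 2)^-1)%:E)%E) => //.
- by apply/measurable_EFinP; exact: continuous_measurable_fun.
- by move=> x _ /=; rewrite lee_fin (le_trans (hC x))// ler_norm.
- by apply: integrableZl => //; exact: integrable_oneDsqrV.
Qed.

(** Dominated convergence for the restrictions of [h] to the growing intervals, with [|h|] as
    dominating function. *)
Lemma Rintegral_exhaust (h : R -> R) (c P : R) : 0 < P -> continuous h ->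
  mu.-integrable setT (EFin \o h) -> \int[mu]_x h x = 0 ->
  forall eps : R, 0 < eps -> exists n0, forall n : nat, (n0 <= n)%N ->
    `|\int[mu]_(x in `[c - n%:R * P, c + n%:R * P]) h x| <= eps.
Proof.
move=> P0 ch ih h0 eps eps0.
pose J (n : nat) : set R := `[c - n%:R * P, c + n%:R * P]%classic.
have mJ n : measurable (J n) by exact: measurable_itv.
have mh : measurable_fun setT h by exact: continuous_measurable_fun.
have [] := @dominated_convergence _ _ _ mu setT measurableT
  (fun n => EFin \o (h \_ (J n))) (EFin \o h) (fun x => `|(h x)%:E|%E).
- move=> n; apply/measurable_EFinP.
  by apply: (measurable_restrictT h (mJ n)).1; exact: measurable_funTS.
- exact/measurable_EFinP.
- apply: aeW => x _; apply: cvg_near_cst.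
  exists (Num.trunc (`|x - c| / P)).+1 => // n /= hn; rewrite patchE mem_set//=.
  rewrite /J /= in_itv/= -ler_distl -ler_pdivrMr//.
  apply: le_trans (ltW (truncnS_gt _)) _.
  by rewrite ler_nat.
- exact: integrable_abse.
- apply: aeW => x n _ /=; rewrite lee_fin patchE.
  by case: ifP => // _; rewrite normr0.
move=> _ _.
have -> : (\int[mu]_x (EFin \o h) x)%E = 0%:E.
  by rewrite -h0 /Rintegral fineK//; exact: integrable_fin_num.
move/fine_cvgP => -[_].
move=> /cvgrPdist_le /(_ _ eps0)[n0 _ hn]; exists n0 => n n0n.
have := hn n n0n; rewrite /= sub0r normrN.
by rewrite -[fine _]Rintegral_mkcond.
Qed.

Lemma Rintegral_cells (h : R -> R) (c P : R) (m : nat) : 0 < P -> continuous h ->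
  \int[mu]_(x in `[c, c + m%:R * P]) h x =
  \sum_(j < m) \int[mu]_(x in `[c + j%:R * P, c + j%:R * P + P]) h x.
Proof.
move=> P0 ch; elim: m => [|m IH].
  by rewrite big_ord0 mul0r addr0 set_itv1 Rintegral_set1.
rewrite big_ord_recr/= -IH.
have e : c + m%:R * P + P = c + m.+1%:R * P by rewrite -natr1; ring.
rewrite e.
have m0 : 0 <= m%:R * P by rewrite mulr_ge0// ltW.
have := @Rintegral_itvB R h (BLeft c) (BRight (c + m.+1%:R * P)) (c + m%:R * P)
  (integrable_continuous_itv _ _ ch).
rewrite !bnd_simp lerDl m0 -e lerDl ltW// => /(_ isT isT) H.
rewrite -(@Rintegral_itv_obnd_cbnd R (c + m%:R * P)); last first.
  apply: (@integrableS _ _ _ mu `[c + m%:R * P, c + m%:R * P + P]) => //.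
    by apply: subset_itvr; rewrite bnd_simp.
  exact: integrable_continuous_itv.
by rewrite -H addrC subrK.
Qed.

Lemma le_normr_Rintegral_itv (h k : R -> R) (c d : R) :
  continuous h -> continuous k -> (forall x, c <= x <= d -> `|h x| <= k x) ->
  `|\int[mu]_(x in `[c, d]) h x| <= \int[mu]_(x in `[c, d]) k x.
Proof.
move=> ch ck hk; apply: le_trans (le_normr_Rintegral _ _) _ => //.
  exact: integrable_continuous_itv.
apply: le_Rintegral => //.
- apply: integrable_continuous_itv => x.
  by apply: continuous_comp; [exact: ch|exact: norm_continuous].
- exact: integrable_continuous_itv.
Qed.

End IntegralsOnTheLine.

(** * Concentration of the Fejer kernel at a point *)

Section FejerConvolution.
Context {R : realType}.
Notation mu := (@lebesgue_measure R).

(** The double sum is real, since exchanging [k] and [l] conjugates it. This form can be multiplied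
    by a complex kernel before the real part is taken. *)
Lemma fejerCE n (x : R) : ((fejer n x)%:C)%C =
  ((n%:R^-1)%:C)%C * \sum_(k < n) \sum_(l < n) cis ((k%:R - l%:R) * x).
Proof.
set S := \sum_(k < n) _.
have S0 : Im S = 0.
  have H : Im S = - Im S.
    rewrite {2}/S exchange_big /= /S !Im_sum -sumrN; apply: eq_bigr => k _.
    rewrite !Im_sum -sumrN; apply: eq_bigr => l _.
    by rewrite -[l%:R - k%:R]opprB mulNr !Im_cis mulrN sinN opprK.
  lra.
rewrite (complexE S) S0 mulr0 addr0 -rmorphM; congr (_%:C)%C.
rewrite fejerE; congr (_ * _); rewrite Re_sum.
by apply: eq_bigr => k _; rewrite Re_sum.
Qed.

Lemma fejer_period n (x : R) (m : int) : fejer n (x + m%:~R) = fejer n x.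
Proof.
rewrite /fejer; congr (normc _ ^+ 2 / _); apply: eq_bigr => k _.
rewrite mulrDr cisD; have -> : k%:R * m%:~R = (k%:Z * m)%:~R :> R by rewrite intrM.
by rewrite cis_int mulr1.
Qed.

(* A quadratic majorant of the oscillation, against which the kernel has mass at
   most [4 / n] by [fejer_chord]. *)
Lemma fejer_approx (g : R -> R) (P B y : R) : 0 < P -> continuous g ->
  (forall x, `|g x| <= B) -> forall eps : R, 0 < eps ->
  exists N0, forall n, (N0 < n)%N ->
  `|\int[mu]_(x in `[y - P / 2, y - P / 2 + P]) (g x * fejer n (P^-1 * (x - y)))
    - P * g y| <= eps.
Proof.
move=> P0 cg gB eps eps0.
(* The oscillation near [y] costs [eta * P = eps / 2]; the rest of the cell is left the other
   half. *)
pose eta := eps / (2 * P).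
have eta0 : 0 < eta by rewrite divr_gt0// mulr_gt0.
have B0 : 0 <= B by apply: le_trans (gB 0).
have [r r0 hr] : exists2 r : R, 0 < r & forall x, `|x - y| < r -> `|g x - g y| <= eta.
  have /cvgrPdist_le /(_ _ eta0) := cg y.
  rewrite nearE /= => /nbhs_ballP[r /= r0 hr]; exists r => // x xy.
  by rewrite distrC; apply: hr; rewrite /ball /= distrC.
(* The radius [r] in the rescaled variable, capped at half a period, where the chord stops
   growing. *)
pose r' := Num.min (r / P) 2^-1.
have r'0 : 0 < r' by rewrite lt_min divr_gt0//= invr_gt0.
have r'2 : r' <= 2^-1 by rewrite ge_min lexx orbT.
set rho := 2 - 2 * cos (2 * pi * r').
have rho0 : 0 < rho by exact: chord_lb_gt0.
have major x : y - P / 2 <= x <= y - P / 2 + P ->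
   `|g x - g y| <= eta + 2 * B / rho * normc (1 - cis (P^-1 * (x - y))) ^+ 2.
  move=> /andP[x1 x2].
  have c0 : 0 <= normc (1 - cis (P^-1 * (x - y))) ^+ 2 by rewrite exprn_ge0 ?normc_ge0.
  have [xr|xr] := ltP `|x - y| r.
    apply: le_trans (hr _ xr) _; rewrite lerDl mulr_ge0// divr_ge0// ?mulr_ge0//.
    exact: ltW.
  have l : rho <= normc (1 - cis (P^-1 * (x - y))) ^+ 2.
    apply: chord_lb => //; rewrite normrM gtr0_norm ?invr_gt0//.
    rewrite ge_min -[r / P]mulrC ler_pM2l ?invr_gt0// xr/=.
    rewrite ler_pdivrMl// ler_norml; lra.
  apply: (@le_trans _ _ (2 * B)).
    apply: le_trans (ler_normB _ _) _; have := gB x; have := gB y; lra.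
  apply: (@le_trans _ _ (2 * B / rho * rho)); first by rewrite mulfVK// gt_eqF.
  apply: ler_wpDl; first exact: ltW.
  by apply: ler_wpM2l => //; rewrite divr_ge0 ?mulr_ge0// ltW.
set K := 2 * B / rho in major.
have K0 : 0 <= K by rewrite divr_ge0 ?mulr_ge0// ltW.
exists (Num.trunc (8 * K * P / eps)) => n nN.
have n0 : (0 < n)%N by apply: leq_ltn_trans nN.
have nK : 8 * K * P / eps < n%:R.
  by apply: lt_le_trans (truncnS_gt _) _; rewrite ler_nat.
pose F x := fejer n (P^-1 * (x - y)).
have cF : continuous F by exact: continuous_fejer.
have cgF : continuous (fun x => g x * F x).
  by move=> x; apply: cvgM; [exact: cg|exact: cF].
have cyF : continuous (fun x => g y * F x).
  by move=> x; apply: cvgM; [exact: cvg_cst|exact: cF].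
have e : P * g y = \int[mu]_(x in `[y - P / 2, y - P / 2 + P]) (g y * F x).
  rewrite RintegralZl//; last exact: integrable_continuous_itv.
  by rewrite fejer_int// mulrC.
rewrite e -RintegralB//; [|exact: integrable_continuous_itv..].
pose k x := eta * F x + 4 * K / n%:R.
have ceF : continuous (fun x => eta * F x).
  by move=> x; apply: cvgM; [exact: cvg_cst|exact: cF].
apply: le_trans (@le_normr_Rintegral_itv _ _ k _ _ _ _ _) _.
- by move=> x; apply: cvgB; [exact: cgF|exact: cyF].
- by move=> x; apply: cvgD; [exact: ceF|exact: cvg_cst].
- move=> x xI; rewrite -mulrBl normrM (ger0_norm (fejer_ge0 _ _)).
  apply: le_trans (ler_wpM2r (fejer_ge0 _ _) (major x xI)) _.
  rewrite mulrDl lerD2l.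
  have -> : 4 * K / n%:R = K * (4 / n%:R) by ring.
  by rewrite -mulrA; apply: ler_wpM2l => //; exact: fejer_chord.
rewrite RintegralD//; last 2 first.
- exact: integrable_continuous_itv.
- by apply: integrable_continuous_itv => x; exact: cvg_cst.
rewrite RintegralZl//; last exact: integrable_continuous_itv.
rewrite fejer_int// Rintegral_cst// lebesgue_itv_len; last by rewrite lerDl ltW.
rewrite [_ + P]addrC addrK /eta.
have -> : eps / (2 * P) * P = eps / 2.
  by rewrite invfM mulrA mulfVK// gt_eqF.
suff : 4 * K / n%:R * P <= eps / 2 by lra.
rewrite mulrAC ler_pdivrMr ?ltr0n//.
move: nK; rewrite ltr_pdivrMr// => /ltW nK.
have -> : eps / 2 * n%:R = n%:R * eps / 2 by ring.
have -> : 4 * K * P = 8 * K * P / 2 by field.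
by rewrite ler_pM2r// invr_gt0.
Qed.

Lemma fejer_approx_seq (g : R -> R) (P B : R) (s : seq R) : 0 < P -> continuous g ->
  (forall x, `|g x| <= B) -> forall eps : R, 0 < eps ->
  exists N0, forall n, (N0 < n)%N ->
  `|\sum_(y <- s) (\int[mu]_(x in `[y - P / 2, y - P / 2 + P])
       (g x * fejer n (P^-1 * (x - y))) - P * g y)| <= eps.
Proof.
move=> P0 cg gB; elim: s => [|y s IH] eps eps0.
  by exists 0%N => n _; rewrite big_nil normr0 ltW.
have e2 : 0 < eps / 2 by rewrite divr_gt0.
have [N1 h1] := IH _ e2; have [N2 h2] := fejer_approx y P0 cg gB e2.
exists (maxn N1 N2) => n; rewrite gtn_max => /andP[n1 n2].
rewrite big_cons (le_trans (ler_normD _ _))// [leRHS]splitr.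
by rewrite lerD ?h1 ?h2.
Qed.
End FejerConvolution.

(** * The Poisson estimate *)

Section PoissonEstimate.
Context {R : realType}.
Notation mu := (@lebesgue_measure R).

(** Telescoping: for [x >= 1], [1 / x ^ 2 <= 2 / (x (x + 1)) = 2 / x - 2 / (x + 1)]. *)
Lemma sum_inv_sqr_le (q d : nat) : (0 < q)%N ->
  \sum_(0 <= j < d) ((q + j)%:R ^+ 2)^-1 <= 2 / q%:R :> R.
Proof.
move=> q0.
suff : \sum_(0 <= j < d) ((q + j)%:R ^+ 2)^-1 <= 2 / q%:R - 2 / (q + d)%:R :> R.
  by move=> /le_trans; apply; rewrite gerBl divr_ge0.
elim: d => [|d IH]; first by rewrite big_nil addn0 subrr.
rewrite big_nat_recr//= addnS.
set x : R := (q + d)%:R.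
have -> : (q + d).+1%:R = x + 1 :> R by rewrite -natr1.
have x1 : 1 <= x by rewrite /x ler1n addn_gt0 q0.
apply: le_trans (lerD IH (lexx _)) _; rewrite -/x.
have -> : 2 / q%:R - 2 / (x + 1) = 2 / q%:R - 2 / x + (2 / x - 2 / (x + 1)) by ring.
rewrite lerD2l.
have -> : 2 / x - 2 / (x + 1) = 2 / (x * (x + 1)) by field; lra.
rewrite -div1r ler_pdivrMr; last by rewrite exprn_gt0//; lra.
rewrite mulrAC ler_pdivlMr; last by rewrite mulr_gt0; lra.
by rewrite expr2; nra.
Qed.

Variables (u v : R -> R) (a C : R).
Hypotheses (a0 : 0 < a) (cu : continuous u) (cv : continuous v).
Let f x : R[i] := (u x +i* v x)%C.
Hypothesis fC : forall x, normc (f x) <= C / (1 + x ^+ 2).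

Lemma decay_cst_ge0 : 0 <= C.
Proof.
have := le_trans (normc_ge0 _) (fC 0).
by rewrite expr0n/= addr0 divr1.
Qed.

(** The quarter leaves room for the offset [x0] of a sample and for half a cell, when the nominal
    distance from the origin is [m / a]. *)
Lemma decay_le (x : R) (m : nat) : (0 < m)%N -> m%:R / a / 4 <= `|x| ->
  normc (f x) <= 16 * a ^+ 2 * C * (m%:R ^+ 2)^-1.
Proof.
move=> m0 mx; apply: le_trans (fC x) _.
have m0' : 0 < m%:R :> R by rewrite ltr0n.
have -> : 16 * a ^+ 2 * C * (m%:R ^+ 2)^-1 = C / (m%:R / a / 4) ^+ 2.
  by field; rewrite !gt_eqF.
rewrite ler_wpM2l ?decay_cst_ge0// lef_pV2 ?posrE; last 2 first.
- by rewrite ltr_wpDr ?sqr_ge0.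
- by rewrite exprn_gt0// !divr_gt0.
apply: ler_wpDl => //; rewrite -[leRHS]real_normK ?num_real//.
by rewrite lerXn2r ?nnegrE// ltW// !divr_gt0.
Qed.

Lemma Re_fourier_kernel (d : R[i]) (s x : R) : Re (d * (f x * cis (- (s * x)))) =
  Re d * (u x * cos (2 * pi * s * x) + v x * sin (2 * pi * s * x))
  - Im d * (v x * cos (2 * pi * s * x) - u x * sin (2 * pi * s * x)).
Proof.
rewrite ReCM ImCM ReCM Re_cis Im_cis mulrN cosN sinN !mulrA /=.
by ring.
Qed.

Lemma normr_Re_kernel (d : R[i]) (s x : R) : normc d = 1 ->
  `|Re (d * (f x * cis (- (s * x))))| <= C / (1 + x ^+ 2).
Proof.
move=> d1; apply: le_trans (normc_Re _) _.
by rewrite !normcM normc_cis d1 mul1r mulr1.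
Qed.

Lemma continuous_Re_kernel (d : R[i]) (s : R) :
  continuous (fun x => Re (d * (f x * cis (- (s * x))))).
Proof.
move=> x; under eq_fun do rewrite Re_fourier_kernel.
have cc := @continuous_lin_cos R (2 * pi * s) x.
have cs := @continuous_lin_sin R (2 * pi * s) x.
apply: cvgB; apply: cvgM; try exact: cvg_cst.
- by apply: cvgD; apply: cvgM; [exact: cu|exact: cc|exact: cv|exact: cs].
- by apply: cvgB; apply: cvgM; [exact: cv|exact: cc|exact: cu|exact: cs].
Qed.

Lemma integrable_Re_kernel (d : R[i]) (s : R) :
  mu.-integrable setT (EFin \o (fun x => Re (d * (f x * cis (- (s * x)))))).
Proof.
apply: (@integrable_decay _ _ (normc d * C)); first exact: continuous_Re_kernel.
move=> x; apply: le_trans (normc_Re _) _.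
by rewrite !normcM normc_cis mulr1 -mulrA ler_wpM2l ?normc_ge0.
Qed.

Lemma Rintegral_Re_kernel (d : R[i]) (s : R) :
  fourier_re u v s = 0 -> fourier_im u v s = 0 ->
  \int[mu]_x Re (d * (f x * cis (- (s * x)))) = 0.
Proof.
move=> hr hi; under eq_Rintegral do rewrite Re_fourier_kernel.
have e1 x : u x * cos (2 * pi * s * x) + v x * sin (2 * pi * s * x) =
    Re (1 * (f x * cis (- (s * x)))).
  by rewrite Re_fourier_kernel /= mul1r mul0r subr0.
have e2 x : v x * cos (2 * pi * s * x) - u x * sin (2 * pi * s * x) =
    Re ((0 -i* 1)%C * (f x * cis (- (s * x)))).
  by rewrite Re_fourier_kernel /= mul0r mulNr mul1r opprK add0r.
have i1 : mu.-integrable setT (EFin \o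
    (fun x => u x * cos (2 * pi * s * x) + v x * sin (2 * pi * s * x))).
  by under [X in _ \o X]eq_fun do rewrite e1; exact: integrable_Re_kernel.
have i2 : mu.-integrable setT (EFin \o
    (fun x => v x * cos (2 * pi * s * x) - u x * sin (2 * pi * s * x))).
  by under [X in _ \o X]eq_fun do rewrite e2; exact: integrable_Re_kernel.
rewrite RintegralB//=; [|exact: (integrableZl measurableT _ i1)
  |exact: (integrableZl measurableT _ i2)].
by rewrite !RintegralZl// [X in _ * X - _]hr [X in _ - _ * X]hi !mulr0 subrr.
Qed.

Variable t : R.
Hypothesis ft : forall k : int,
  fourier_re u v (t + k%:~R * a) = 0 /\ fourier_im u v (t + k%:~R * a) = 0.

(** Expanding the kernel shifts the frequency [t] by multiples [(l - k) a], and at all these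
    frequencies the Fourier transform vanishes by [ft]. This is a finite form of the vanishing of
    the periodization. *)
Lemma Rintegral_kernel_fejer (c : R[i]) (n : nat) (x0 : R) :
  \int[mu]_x (Re (c * (f x * cis (- (t * x)))) * fejer n (a * (x - x0))) = 0.
Proof.
pose sh (k l : 'I_n) : R := t + ((l%:Z - k%:Z)%:~R) * a.
pose d (k l : 'I_n) : R[i] := c * cis (- ((k%:R - l%:R) * (a * x0))).
have E x : Re (c * (f x * cis (- (t * x)))) * fejer n (a * (x - x0)) =
   n%:R^-1 * \sum_(kl : 'I_n * 'I_n)
     Re (d kl.1 kl.2 * (f x * cis (- (sh kl.1 kl.2 * x)))).
  have -> (z : R[i]) (w : R) : Re z * w = Re (z * (w%:C)%C).
    by rewrite ReCM /= mulr0 subr0.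
  rewrite fejerCE mulrCA ReCM /= mul0r subr0; congr (_ * _).
  rewrite pair_big /= mulr_sumr Re_sum; apply: eq_bigr => -[k l] _ /=.
  rewrite /d -!mulrA; congr (Re (c * _)).
  rewrite [RHS]mulrCA -!cisD; congr (_ * cis _).
  by rewrite /sh intrB -!pmulrn; ring.
under eq_Rintegral do rewrite E.
rewrite RintegralZl//; last first.
  have := @integrable_sum _ _ _ mu setT measurableT _ (index_enum _) xpredT
    (fun kl => EFin \o (fun x => Re (d kl.1 kl.2 * (f x * cis (- (sh kl.1 kl.2 * x))))))
    (fun kl _ => integrable_Re_kernel _ _).
  by congr (_.-integrable _ _); apply/funext => x /=; rewrite sumEFin.
rewrite Rintegral_sum//; last by move=> kl; exact: integrable_Re_kernel.
rewrite big1 ?mulr0// => kl _.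
by have [hr hi] := ft (kl.2%:Z - kl.1%:Z); exact: Rintegral_Re_kernel.
Qed.

(** The line is cut into cells of length [1 / a] centred at the points [x0 + j / a], and [g] is
    integrated against the Fejer kernel, with total 0. The cells with [- K <= j < q] give nearly
    [1 / a] times the sum; by decay and the mass of the kernel, the others on either side give at
    most [32 a C / q]. *)
Lemma poisson_bound (x0 : R) (K q : nat) : 0 <= x0 -> (0 < q <= K)%N ->
  4 * a * x0 <= K%:R ->
  normc (\sum_(i < K + q) f (x0 + (i%:R - K%:R) / a) *
     cis (- (t * (x0 + (i%:R - K%:R) / a)))) <= 64 * a ^+ 2 * C / q%:R.
Proof.
move=> x00 /andP[q0 qK] aK.
have C0 := decay_cst_ge0.
set Z := \sum_(i < _) _; have [c c1 <-] := normc_phase Z.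
pose g x := Re (c * (f x * cis (- (t * x)))).
pose y (i : nat) := x0 + (i%:R - K%:R) / a.
have -> : Re (c * Z) = \sum_(i < K + q) g (y i) by rewrite mulr_sumr Re_sum.
pose P := a^-1; have P0 : 0 < P by rewrite invr_gt0.
have cg : continuous g by exact: continuous_Re_kernel.
have gB x : `|g x| <= C.
  apply: le_trans (normr_Re_kernel _ _ c1) _.
  by rewrite ler_pdivrMr ?ltr_wpDr ?sqr_ge0// ler_peMr// lerDl sqr_ge0.
apply/ler_addgt0Pr => eps eps0.
(* Two errors of size [e'] occur, one from concentrating the kernel and one from truncating the
   line; dividing by [P] turns them into [eps]. *)
pose e' := eps * P / 2; have e'0 : 0 < e' by rewrite divr_gt0 ?mulr_gt0.
have [N0 hN] := fejer_approx_seq [seq y i | i <- iota 0 (K + q)] P0 cg gB e'0.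
pose N := N0.+1; have {hN} hN := hN N (ltnSn _).
pose F x := fejer N (P^-1 * (x - x0)).
pose h x := g x * F x.
have cF : continuous F by exact: continuous_fejer.
have ch : continuous h by move=> x; apply: cvgM; [exact: cg|exact: cF].
have h0 : \int[mu]_x h x = 0.
  by rewrite /h /F /P invrK; exact: Rintegral_kernel_fejer.
have ih : mu.-integrable setT (EFin \o h).
  apply: (@integrable_decay _ _ (C * N%:R)) => // x.
  rewrite normrM (ger0_norm (fejer_ge0 _ _)) mulrAC.
  by apply: ler_pM; rewrite ?fejer_ge0 ?fejer_le//; exact: normr_Re_kernel.
have [n1 hn] := Rintegral_exhaust (x0 - P / 2) P0 ch ih h0 e'0.
pose n := maxn n1 K.
have nK : (K <= n)%N by rewrite leq_maxr.
have nq : (q <= n)%N by exact: leq_trans nK.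
have {hn} := hn n (leq_maxl _ _).
(* The truncated line consists of [2n] cells; cell [j] is centred at [x0 + (j - n) P], so the
   summand of index [i] belongs to cell [n - K + i]. *)
have -> : x0 - P / 2 + n%:R * P = x0 - P / 2 - n%:R * P + (n + n)%:R * P.
  by rewrite natrD; ring.
rewrite Rintegral_cells//.
set X := fun j : nat => \int[mu]_(x in `[x0 - P / 2 - n%:R * P + j%:R * P,
  x0 - P / 2 - n%:R * P + j%:R * P + P]) h x.
rewrite -(big_mkord xpredT X) => hX.
have tail j m : (0 < m)%N -> (forall x, x0 - P / 2 - n%:R * P + j%:R * P <= x <=
     x0 - P / 2 - n%:R * P + j%:R * P + P -> m%:R / a / 4 <= `|x|) ->
   `|X j| <= 16 * a ^+ 2 * C * P * (m%:R ^+ 2)^-1.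
  move=> m0 hx; rewrite /X.
  apply: le_trans (@le_normr_Rintegral_itv _ h
    (fun x => 16 * a ^+ 2 * C * (m%:R ^+ 2)^-1 * F x) _ _ ch _ _) _.
  - by move=> x; apply: cvgM; [exact: cvg_cst|exact: cF].
  - move=> x xI; rewrite normrM (ger0_norm (fejer_ge0 _ _)).
    apply: ler_wpM2r; first exact: fejer_ge0.
    apply: le_trans (normc_Re _) _.
    rewrite !normcM normc_cis c1 mul1r mulr1; apply: decay_le => //; exact: hx.
  rewrite RintegralZl//; last exact: integrable_continuous_itv.
  rewrite fejer_int// le_eqVlt; apply/orP; left; apply/eqP; ring.
(* Periodicity moves the centre of the kernel from [x0] to the sample point of the cell. *)
have mid i : X (n - K + i)%N = \int[mu]_(x in `[y i - P / 2, y i - P / 2 + P])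
     (g x * fejer N (P^-1 * (x - y i))).
  rewrite /X.
  have -> : x0 - P / 2 - n%:R * P + (n - K + i)%:R * P = y i - P / 2.
    by rewrite natrD natrB// /y -/P; ring.
  apply: eq_Rintegral => x _; rewrite /h /F; congr (_ * _).
  have -> : P^-1 * (x - x0) = P^-1 * (x - y i) + (i%:Z - K%:Z)%:~R.
    rewrite /y -/P intrB -!pmulrn; field; exact: lt0r_neq0.
  exact: fejer_period.
have e1 : (n - K <= n + q)%N by rewrite (leq_trans (leq_subr _ _)) ?leq_addr.
have e2 : (n + q <= n + n)%N by rewrite leq_add2l.
have e3 : (n - K <= n + n)%N by exact: leq_trans e2.
rewrite (@big_cat_nat _ _ _ (n - K)%N)//= (@big_cat_nat _ _ _ (n + q)%N (n - K))//= in hX.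
have Pmid : \sum_(n - K <= j < n + q) X j - P * \sum_(i < K + q) g (y i) =
   \sum_(y <- [seq y i | i <- iota 0 (K + q)])
     (\int[mu]_(x in `[y - P / 2, y - P / 2 + P])
       (g x * fejer N (P^-1 * (x - y))) - P * g y).
  rewrite big_map sumrB.
  have -> : iota 0 (K + q) = index_iota 0 (K + q) by rewrite /index_iota subn0.
  congr (_ - _).
    rewrite -{1}[(n - K)%N]add0n big_addn; have -> : (n + q - (n - K) = K + q)%N.
      by rewrite addnC -addnBA ?leq_subr// subKn// addnC.
    by apply: eq_bigr => i _; rewrite addnC mid.
  by rewrite -mulr_sumr big_mkord.
rewrite -Pmid in hN.
have c16 : 0 <= 16 * a ^+ 2 * C * P.
  by rewrite !mulr_ge0// ?sqr_ge0// ltW.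
(* After reversal the [j]-th cell is centred [K + 1 + j] steps to the left of [x0]. Of this distance
   [x0] absorbs at most a quarter, by [aK], and half a cell at most one half; a quarter remains. *)
have left_tail : `|\sum_(0 <= j < n - K) X j| <= 16 * a ^+ 2 * C * P * (2 / q%:R).
  rewrite big_nat_rev/= add0n.
  apply: le_trans (ler_norm_sum _ _ _) _.
  apply: (@le_trans _ _ (16 * a ^+ 2 * C * P * (2 / K.+1%:R))); last first.
    rewrite ler_wpM2l// ler_wpM2l// lef_pV2 ?posrE ?ltr0n// ler_nat.
    exact: leqW.
  apply: le_trans (ler_wpM2l c16 (@sum_inv_sqr_le K.+1 (n - K) isT)).
  rewrite mulr_sumr; apply: ler_sum_nat => j /andP[_ jn].
  apply: tail => // x /andP[_ x2].
  have jE : (n - K - j.+1)%:R = n%:R - (K.+1 + j)%:R :> R.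
    by rewrite -subnDA -addSnnS natrB// addSn -ltn_subRL.
  have K1 : 1 <= (K.+1 + j)%:R :> R by rewrite ler1n.
  have Kj : K%:R <= (K.+1 + j)%:R :> R by rewrite ler_nat addSnnS leq_addr.
  move: x2; rewrite jE; set m : R := (K.+1 + j)%:R in K1 Kj *.
  rewrite -/P => x2.
  have x0P : x0 <= m * P / 4.
    have : x0 * 4 <= m * P; last lra.
    rewrite ler_pdivlMr//; apply: le_trans Kj; apply: le_trans aK.
    by rewrite le_eqVlt; apply/orP; left; apply/eqP; ring.
  have mP : P <= m * P by rewrite ler_peMl// ltW.
  by have := ler_norm (- x); rewrite normrN; lra.
have right_tail : `|\sum_(n + q <= j < n + n) X j| <= 16 * a ^+ 2 * C * P * (2 / q%:R).
  rewrite -{1}[(n + q)%N]add0n big_addn.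
  apply: le_trans (ler_norm_sum _ _ _) _.
  apply: le_trans (ler_wpM2l c16 (@sum_inv_sqr_le q (n + n - (n + q)) q0)).
  rewrite mulr_sumr; apply: ler_sum_nat => j _.
  apply: tail => [|x /andP[x1 _]]; first by rewrite addn_gt0 q0.
  move: x1; have -> : (j + (n + q))%:R = n%:R + (q + j)%:R :> R.
    by rewrite addnC -addnA natrD.
  have K1 : 1 <= (q + j)%:R :> R by rewrite ler1n addn_gt0 q0.
  set m : R := (q + j)%:R in K1 *; rewrite -/P => x1.
  have mP : P <= m * P by rewrite ler_peMl// ltW.
  apply: le_trans (ler_norm x); lra.
have -> : 64 * a ^+ 2 * C / q%:R = P^-1 * (16 * a ^+ 2 * C * P * (2 / q%:R) * 2).
  by field; rewrite ?lt0r_neq0//= ?ltr0n.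
have -> : eps = P^-1 * (e' * 2) by rewrite /e'; field; exact: lt0r_neq0.
rewrite -mulrDr ler_pdivlMl//.
move: hN hX left_tail right_tail; rewrite !ler_norml; lra.
Qed.

End PoissonEstimate.

(** * Polynomials small outside a compact set *)

Section TrigonometricPolynomials.
Context {R : realType}.
Notation mu := (@lebesgue_measure R).
Implicit Types p : {poly R[i]}.

Lemma horner_cisE p (x : R) : p.[cis x] = \sum_(i < size p) p`_i * cis (i%:R * x).
Proof. by rewrite horner_coef; apply: eq_bigr => i _; rewrite cisMn. Qed.

Lemma normc_horner_cis p (x : R) : normc p.[cis x] <= \sum_(i < size p) normc p`_i.
Proof.
rewrite horner_cisE; apply: le_trans (normc_sum _ _ _) _.
by apply: ler_sum => i _; rewrite normcM normc_cis mulr1.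
Qed.

Lemma continuous_Re_cisM (b : R[i]) (c w : R) :
  continuous (fun x => Re (b * cis (c * (w * x)))).
Proof.
have -> : (fun x => Re (b * cis (c * (w * x)))) =
    (fun x => Re (b * cis ((c * w) * (x - 0)))).
  by apply/funext => x; rewrite subr0 mulrA.
exact: continuous_Re_cis.
Qed.

Lemma continuous_Re_horner p (w : R) : continuous (fun x => Re p.[cis (w * x)]).
Proof.
move=> x; under eq_fun do rewrite horner_cisE Re_sum.
by move: x; apply: continuous_bigsum => i; exact: continuous_Re_cisM.
Qed.

Lemma continuous_normc_horner p (w : R) :
  continuous (fun x => normc p.[cis (w * x)]).
Proof.
move=> x.
have ImE y : Im p.[cis (w * y)] = Re ((0 -i* 1)%C *: p).[cis (w * y)].
  by rewrite hornerZ ReCM /= mul0r mulN1r opprK add0r.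
have E y : normc p.[cis (w * y)] =
    Num.sqrt (Re p.[cis (w * y)] ^+ 2 + Im p.[cis (w * y)] ^+ 2).
  by case: (p.[_]).
under eq_fun do rewrite E ImE.
apply: continuous_comp; last exact: sqrt_continuous.
by apply: cvgD; apply: cvgM; exact: continuous_Re_horner.
Qed.

(** The mean value property at the origin, obtained term by term. *)
Lemma Rintegral_Re_horner p (P : R) : 0 < P ->
  \int[mu]_(x in `[0, P]) Re p.[cis (P^-1 * x)] = P * Re p`_0.
Proof.
move=> P0; have nP : P != 0 by rewrite gt_eqF.
under eq_Rintegral do rewrite horner_cisE Re_sum.
have cont (i : nat) : continuous (fun x => Re (p`_i * cis (i%:R * (P^-1 * x)))).
  exact: continuous_Re_cisM.
rewrite Rintegral_sum//; last by move=> i; exact: integrable_continuous_itv.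
have term0 : \int[mu]_(x in `[0, P]) Re (p`_0 * cis (0%:R * (P^-1 * x))) = P * Re p`_0.
  under eq_Rintegral do rewrite mul0r cis0 mulr1.
  by rewrite Rintegral_cst// lebesgue_itv_len ?ltW// subr0 mulrC.
have termS (i : nat) : (0 < i)%N ->
    \int[mu]_(x in `[0, P]) Re (p`_i * cis (i%:R * (P^-1 * x))) = 0.
  move=> i0; under eq_Rintegral do rewrite mulrA.
  have := @Rintegral_cis R p`_i (i%:R / P) P 0 P0; rewrite add0r; apply.
    by rewrite mulf_neq0 ?invr_eq0// pnatr_eq0 -lt0n.
  by rewrite mulfVK// cis_nat.
case E : (size p) => [|n].
  rewrite big_ord0; move/eqP: E; rewrite size_poly_eq0 => /eqP ->.
  by rewrite coef0 mulr0.
by rewrite big_ord_recl/= term0 big1 ?addr0// => i _; exact: termS.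
Qed.

(* The Fejer means of [phi], sampled at the [n] points [j / n]. *)
Lemma trig_approx (phi : R -> R) (L : R) : 0 <= L ->
  (forall x y, `|phi x - phi y| <= L * normc (1 - cis (x - y))) ->
  forall eps : R, 0 < eps -> exists p, forall x, `|Re p.[cis x] - phi x| <= eps.
Proof.
move=> L0 lip eps eps0.
pose eta := eps / (L + 1).
have eta0 : 0 < eta by rewrite divr_gt0// ltr_wpDl.
have h1 : L * eta <= eps.
  rewrite /eta mulrCA -[leRHS]mulr1 ler_pM2l// ler_pdivrMr ?ltr_wpDl//; lra.
clearbody eta.
(* The Lipschitz bound is linear in the chord, while [fejer_chord] controls its square; the
   arithmetic-geometric mean inequality bridges the two. *)
have amgm (z : R) : z <= eta / 2 + z ^+ 2 / (2 * eta).
  have -> : eta / 2 + z ^+ 2 / (2 * eta) = (eta ^+ 2 + z ^+ 2) / (2 * eta).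
    by field; rewrite gt_eqF.
  rewrite ler_pdivlMr; last by apply: mulr_gt0.
  rewrite -subr_ge0.
  have -> : eta ^+ 2 + z ^+ 2 - z * (2 * eta) = (eta - z) ^+ 2 by ring.
  exact: sqr_ge0.
pose n := (Num.trunc (4 * L / (eta * eps))).+1.
have nn : n%:R != 0 :> R by rewrite pnatr_eq0.
have n0 : 0 < n%:R :> R by rewrite ltr0n.
(* This is [|k - l|], as one of the two truncated differences is 0. Replacing [k - l] by it makes
   the mean a polynomial without negative powers and keeps the real part, the cosine being even. *)
pose m (kl : 'I_n * 'I_n) := ((kl.1 - kl.2) + (kl.2 - kl.1))%N.
pose node (j : 'I_n) : R := j%:R / n%:R.
pose p : {poly R[i]} := \sum_(j < n) \sum_(kl : 'I_n * 'I_n)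
   (((phi (node j) / n%:R ^+ 2)%:C)%C * cis (- ((m kl)%:R * node j))) *: 'X^(m kl).
have pE x : Re p.[cis x] = \sum_(j < n) fejer n (x - node j) / n%:R * phi (node j).
  rewrite horner_sum Re_sum; apply: eq_bigr => j _.
  rewrite horner_sum Re_sum fejerE pair_big /= !mulr_sumr !mulr_suml.
  apply: eq_bigr => -[k l] _ /=; rewrite hornerZ hornerXn -cisMn -[X in Re X = _]mulrA -cisD.
  rewrite ReCM /= mul0r subr0.
  have -> : - ((m (k, l))%:R * node j) + (m (k, l))%:R * x = (m (k, l))%:R * (x - node j).
    by ring.
  have -> : Re (cis ((m (k, l))%:R * (x - node j))) =
       Re (cis ((k%:R - l%:R) * (x - node j))).
    rewrite !Re_cis /m /=; have [kl|lk] := leqP k l.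
      rewrite (eqP (kl : k - l == 0)%N) add0n natrB// -[l%:R - k%:R]opprB.
      by rewrite mulNr mulrN cosN.
    by rewrite [X in (_ + X)%N](eqP (ltnW lk : l - k == 0)%N) addn0 natrB// ltnW.
  by field.
exists p => x; rewrite pE.
have w1 : \sum_(j < n) fejer n (x - node j) / n%:R = 1.
  by rewrite -mulr_suml fejer_nodes// divff.
have -> : phi x = \sum_(j < n) fejer n (x - node j) / n%:R * phi x.
  by rewrite -mulr_suml w1 mul1r.
rewrite -sumrB; apply: le_trans (ler_norm_sum _ _ _) _.
pose b (j : 'I_n) := L * (eta / 2) * (fejer n (x - node j) / n%:R) +
   L / (2 * eta) * (4 / n%:R ^+ 2).
apply: (@le_trans _ _ (\sum_(j < n) b j)).
  apply: ler_sum => j _; rewrite -mulrBr normrM.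
  set F := fejer n (x - node j).
  have F0 : 0 <= F / n%:R by rewrite divr_ge0// fejer_ge0.
  rewrite (ger0_norm F0).
  set c := normc (1 - cis (x - node j)).
  have cl : `|phi (node j) - phi x| <= L * c by rewrite distrC lip.
  apply: le_trans (ler_wpM2l F0 cl) _.
  have cF : F / n%:R * c ^+ 2 <= 4 / n%:R ^+ 2.
    have -> : F / n%:R * c ^+ 2 = c ^+ 2 * F / n%:R by ring.
    have -> : 4 / n%:R ^+ 2 = 4 / n%:R / n%:R :> R by field.
    by rewrite ler_pM2r ?invr_gt0// fejer_chord.
  apply: le_trans (ler_wpM2l F0 (ler_wpM2l L0 (amgm c))) _.
  have -> : F / n%:R * (L * (eta / 2 + c ^+ 2 / (2 * eta))) =
     L * (eta / 2) * (F / n%:R) + L / (2 * eta) * (F / n%:R * c ^+ 2).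
    by field; rewrite nn gt_eqF.
  rewrite lerD2l ler_wpM2l// divr_ge0// mulr_ge0// ltW//.
rewrite big_split/= -mulr_sumr w1 mulr1 sumr_const card_ord -[_ *+ n]mulr_natr.
have -> : L / (2 * eta) * (4 / n%:R ^+ 2) * n%:R = 2 * L / eta / n%:R.
  by field; rewrite nn gt_eqF.
have h2 : 2 * L / eta / n%:R <= eps / 2.
  rewrite ler_pdivrMr//.
  have : 4 * L / (eta * eps) < n%:R by exact: truncnS_gt.
  rewrite ltr_pdivrMr ?mulr_gt0// => /ltW h.
  rewrite ler_pdivrMr//; nra.
lra.
Qed.

(** For [w = z / n], [|1 + w|^2 = 1 + 2 Re w + |w|^2] is at most the exponential of
    [2 Re w + |w|^2]. Thus a polynomial can replace [exp z] at the price of the factor given by the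
    quadratic term. *)
Lemma normc_pow_le_exp (z : R[i]) (n : nat) : (0 < n)%N ->
  normc ((1 + z * ((n%:R^-1)%:C)%C) ^+ n) <= expR (Re z + normc z ^+ 2 / (2 * n%:R)).
Proof.
move=> n0; have nn : 0 < n%:R :> R by rewrite ltr0n.
set w := z * _; rewrite normcX.
have -> : Re z + normc z ^+ 2 / (2 * n%:R) = (Re w + normc w ^+ 2 / 2) * n%:R.
  rewrite /w normcM normc_real ger0_norm ?invr_ge0// ReCM /= mulr0 subr0.
  by field; rewrite gt_eqF.
rewrite expRM_natr lerXn2r ?nnegrE ?normc_ge0 ?expR_ge0//.
rewrite -(@ler_pXn2r _ 2) ?nnegrE ?normc_ge0 ?expR_ge0//.
rewrite -expRM_natl; apply: le_trans (expR_ge1Dx _).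
rewrite !sqr_normcE; case: (w) => x y /=; rewrite add0r.
by lra.
Qed.

End TrigonometricPolynomials.

(** * Neighbourhoods of a compact set on the circle *)

Section SmallPolynomial.
Context {R : realType}.
Notation mu := (@lebesgue_measure R).
Variables (a : R) (K : set R).
Hypotheses (a0 : 0 < a) (cK : compact K) (Ka : K `<=` `[0, a]).

Let chord (x y : R) : R := normc (1 - cis (x - y)).

Lemma chord_triangle (x y z : R) :
  normc (1 - cis (x - z)) <= normc (1 - cis (x - y)) + normc (1 - cis (y - z)).
Proof.
have -> : 1 - cis (x - z) = (1 - cis (x - y)) + cis (x - y) * (1 - cis (y - z)).
  rewrite mulrBr mulr1 -cisD addrA subrK; congr (_ - cis _); ring.
by rewrite (le_trans (le_normcD _ _))// normcM normc_cis mul1r.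
Qed.

Lemma chord_sym (x y : R) : normc (1 - cis (x - y)) = normc (1 - cis (y - x)).
Proof.
have -> : 1 - cis (x - y) = - cis (x - y) * (1 - cis (y - x)).
  rewrite mulrBr mulr1 mulNr -cisD opprK; have -> : x - y + (y - x) = 0 by ring.
  by rewrite cis0 addrC.
by rewrite normcM normcN normc_cis mul1r.
Qed.

(** A neighbourhood of [K] on the circle of length [a]: points near 0 and near [a] count as
    close. *)
Definition chord_nbhd (w : R) : set R :=
  [set x | exists2 y, K y & normc (1 - cis (a^-1 * x - a^-1 * y)) < w].

Lemma open_chord_nbhd w : open (chord_nbhd w).
Proof.
have -> : chord_nbhd w = \bigcup_(y in K) [set x | chord (a^-1 * x) (a^-1 * y) < w].
  by apply/seteqP; split => x /= [y Ky h]; exists y.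
apply: bigcup_open => y Ky.
have -> : [set x | chord (a^-1 * x) (a^-1 * y) < w] =
  (fun x => normc (1 - cis (- (a^-1 * y)) *: 'X : {poly R[i]}).[cis (a^-1 * x)])
    @^-1` [set z | z < w].
  have e x : (1 - cis (- (a^-1 * y)) *: 'X : {poly R[i]}).[cis (a^-1 * x)] =
      1 - cis (a^-1 * x - a^-1 * y) by rewrite !hornerE mulrC -cisD.
  by apply/seteqP; split => x /=; rewrite e.
apply: open_comp; last exact: open_lt.
by move=> x _; exact: continuous_normc_horner.
Qed.

Definition chord_shell (w : R) : set R := (`[0, a] `\` K) `&` chord_nbhd w.

(** Continuity from above: the shells of width [1 / (n + 1)] decrease to a subset of [{0, a}], a
    null set. The endpoints may survive, for instance [a] if [K] contains 0 but not [a]. *)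
Lemma chord_shell_small (k : R) : 0 < k -> exists2 w : R, 0 < w &
  (mu (chord_shell w) < k%:E)%E.
Proof.
move=> k0.
pose F n := chord_shell n.+1%:R^-1.
have mK : measurable K.
  by apply: closed_measurable; apply: compact_closed => //; exact: Rhausdorff.
have mU : measurable (`[0, a]%classic `\` K : set R) by exact: measurableD.
have mF n : measurable (F n).
  by apply: measurableI => //; apply: open_measurable; exact: open_chord_nbhd.
have mcap : measurable (\bigcap_n F n) by exact: bigcapT_measurable.
have F0 : (mu (F 0%N) < +oo)%E.
  apply: (@le_lt_trans _ _ (mu `[0, a])).
    by apply: le_measure; [rewrite inE; exact: mF|rewrite inE; exact: measurable_itv|move=> x [[]]].
  by rewrite lebesgue_measure_itv/= lte_fin a0 -EFinB ltry.
have capE : mu (\bigcap_n F n) = 0%E.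
  apply: countable_lebesgue_measure0.
  apply: (@sub_countable _ _ _ [set 0; a]); last exact: finite_set_countable.
  apply: subset_card_le => x hx /=.
  have [[/= xI nKx] _] := hx 0%N I.
  apply: contrapT => /not_orP[x0 xa].
  move: xI; rewrite in_itv/= => /andP[]; rewrite !le_eqVlt.
  move=> /orP[/eqP/esym//|x0'] /orP[/eqP//|xa'].
  have [r r0 hr] : exists2 r : R, 0 < r & forall y, K y -> r <= `|x - y|.
    have : closed K by apply: compact_closed => //; exact: Rhausdorff.
    move=> /closed_openC oK.
    have /nbhs_ballP[r /= r0 hr] : nbhs x (~` K) by apply: open_nbhs_nbhs.
    exists r => // y Ky; rewrite leNgt; apply/negP => xy.
    exact: (hr y xy).
  (* On the circle [x] can be near [K] directly or across an endpoint, so the distances from [x] to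
     [K], to 0 and to [a] all enter. *)
  pose r' := Num.min (r / a) (Num.min (x / a) ((a - x) / a)).
  have xa2 : 0 < a - x by rewrite subr_gt0.
  have r'0 : 0 < r' by rewrite !lt_min !divr_gt0.
  have r'2 : r' <= 2^-1.
    rewrite !ge_min !ler_pdivrMr//; apply/orP; right.
    by case: leP => //= h; lra.
  set rho := 2 - 2 * cos (2 * pi * r').
  have rho0 : 0 < rho by exact: chord_lb_gt0.
  have lb y : K y -> rho <= normc (1 - cis (a^-1 * x - a^-1 * y)) ^+ 2.
    move=> Ky; have /Ka := Ky; rewrite /= in_itv/= => /andP[y0 ya].
    have rxy := hr y Ky.
    rewrite -mulrBr; set th := a^-1 * (x - y).
    have thE : `|th| = `|x - y| / a.
      by rewrite normrM gtr0_norm ?invr_gt0// mulrC.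
    have rth : r' <= `|th| by rewrite thE !ge_min ler_pM2r ?invr_gt0// rxy.
    have [h|h] := leP `|th| 2^-1; first by apply: chord_lb => //; rewrite rth h.
    (* More than half a turn: the chord is measured the other way round, with [th - 1] or [th + 1],
       which passes through an endpoint. *)
    have [pos|neg] := ger0P (x - y).
      have thp : th = (x - y) / a by rewrite mulrC.
      have -> : cis th = cis (th - 1).
        by rewrite cisD -[1]/(1%:R) cisN cis_nat conjc1 mulr1.
      have h' : 2^-1 < (x - y) / a by rewrite -[x - y]ger0_norm// -thE.
      have x1 : (x - y) / a <= x / a by rewrite ler_pM2r ?invr_gt0//; lra.
      have x2 : x / a <= 1 by rewrite ler_pdivrMr// mul1r ltW.
      have x3 : (a - x) / a = 1 - x / a by rewrite mulrBl divff// gt_eqF.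
      apply: chord_lb => //; rewrite thp ler0_norm; last by lra.
      rewrite !ge_min x3; apply/andP; split; last lra.
      apply/orP; right; apply/orP; right; lra.
    have thp : th = - ((y - x) / a) by rewrite /th; ring.
    have -> : cis th = cis (th + 1).
      by rewrite cisD -[1]/(1%:R) cis_nat mulr1.
    have h' : 2^-1 < (y - x) / a.
      by have := h; rewrite thE ltr0_norm// opprB.
    have x1 : (y - x) / a <= (a - x) / a by rewrite ler_pM2r ?invr_gt0//; lra.
    have x3 : (a - x) / a = 1 - x / a by rewrite mulrBl divff// gt_eqF.
    have x4 : 0 < x / a by rewrite divr_gt0.
    apply: chord_lb => //; rewrite thp ger0_norm; last by lra.
    rewrite !ge_min; apply/andP; split; last lra.
    apply/orP; right; apply/orP; left; lra.
  pose n := Num.trunc rho^-1.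
  have [_ [y Ky hy]] := hx n I.
  have := lb y Ky; rewrite leNgt => /negP; apply.
  apply: (@lt_le_trans _ _ (n.+1%:R^-1 ^+ 2)).
    by rewrite ltrXn2r// ?nnegrE ?normc_ge0.
  apply: (@le_trans _ _ n.+1%:R^-1).
    by rewrite expr2 ger_pMl ?invr_gt0// invf_le1 ?ler1n.
  rewrite -[leRHS]invrK lef_pV2 ?posrE ?ltr0n ?invr_gt0//.
  by rewrite ltW// truncnS_gt.
have ndF : nonincreasing_seq F.
  move=> m n mn; apply/subsetPset => x [xU [y Ky h]]; split => //; exists y => //.
  by apply: lt_le_trans h _; rewrite lef_pV2 ?posrE ?ltr0n// ler_nat.
have cvF : mu \o F @ \oo --> 0%:E.
  by rewrite -[X in _ --> X]capE; exact: nonincreasing_cvg_mu.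
move/fine_cvgP : cvF => [fin] /cvgrPdist_lt /(_ _ k0) dist.
have [n _ h] := filterI fin dist.
have [/= h1 h2] := h n (leqnn _).
exists n.+1%:R^-1 => //; rewrite -/(F n) -(fineK h1) lte_fin.
by move: h2; rewrite sub0r normrN; exact: le_lt_trans (ler_norm _).
Qed.

End SmallPolynomial.

Section ApproximationArithmetic.
Context {R : realType}.
Implicit Types y z d t : R.

(** This and the next three facts serve [small_outside]: [d] is the proportion of [[0, a]] filled by
    [K], [y] a value of [Re A], [z] the approximated value and [m = Re A(0)]. *)
Lemma near1_ge y d : `|y - 1| <= d / 8 -> 1 - d / 8 <= y.
Proof. by rewrite ler_norml; lra. Qed.

Lemma near_ge0 y d z : `|y - z| <= d / 8 -> 0 <= z <= 1 -> - (d / 8) <= y.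
Proof. by rewrite ler_norml; lra. Qed.

Lemma near0_gap y d m : `|y - 0| <= d / 8 -> 7 / 8 * d <= m -> 3 / 4 * d <= - (y - m).
Proof. by rewrite ler_norml; lra. Qed.

Lemma near_le2 y d m z : `|y - z| <= d / 8 -> 0 <= z <= 1 -> 0 < d -> d <= 1 ->
  7 / 8 * d <= m -> y - m <= 2.
Proof. by rewrite ler_norml; lra. Qed.

End ApproximationArithmetic.

(** * Coefficients of polynomials that are small on a set of positive measure *)

Section SmallOutside.
Context {R : realType}.
Notation mu := (@lebesgue_measure R).
Variables (a : R) (K : set R).
Hypotheses (a0 : 0 < a) (cK : compact K) (Ka : K `<=` `[0, a]).
Hypothesis (K0 : (0%:E < mu K)%E).

Let mK : measurable K.
Proof. by apply: closed_measurable; apply: compact_closed => //; exact: Rhausdorff. Qed.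

Let U : set R := `[0, a] `\` K.

Let mU : measurable U. Proof. exact: measurableD. Qed.

Let itvKU : `[0, a]%classic = K `|` U.
Proof. by rewrite /U setDUK. Qed.

Let fin_itv : mu `[0, a] = a%:E.
Proof. by rewrite lebesgue_measure_itv/= lte_fin a0 -EFinB subr0. Qed.

Let finS (A : set R) : measurable A -> A `<=` `[0, a] ->
  mu A \is a fin_num /\ 0 <= fine (mu A) <= a.
Proof.
move=> mA Aa.
have le : (mu A <= a%:E)%E.
  by rewrite -fin_itv; apply: le_measure => //; rewrite inE//; exact: measurable_itv.
have f : mu A \is a fin_num by rewrite ge0_fin_numE// (le_lt_trans le)// ltry.
by split => //; rewrite fine_ge0// -lee_fin fineK.
Qed.

Let integrable_sub (A : set R) (f : R -> R) : measurable A ->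
  A `<=` `[0, a] -> continuous f -> mu.-integrable A (EFin \o f).
Proof.
move=> mA Aa cf; apply: (@integrableS _ _ _ mu `[0, a]%classic A) => //.
exact: integrable_continuous_itv.
Qed.

Lemma le_Rintegral_cst (A : set R) (f : R -> R) (c : R) : measurable A ->
  A `<=` `[0, a] -> continuous f -> (forall x, A x -> f x <= c) ->
  \int[mu]_(x in A) f x <= c * fine (mu A).
Proof.
move=> mA Aa cf fc; rewrite -Rintegral_cst//; apply: le_Rintegral => //.
  exact: integrable_sub.
by apply: integrable_sub => // x; exact: cvg_cst.
Qed.

Lemma ge_Rintegral_cst (A : set R) (f : R -> R) (c : R) : measurable A ->
  A `<=` `[0, a] -> continuous f -> (forall x, A x -> c <= f x) ->
  c * fine (mu A) <= \int[mu]_(x in A) f x.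
Proof.
move=> mA Aa cf fc; rewrite -Rintegral_cst//; apply: le_Rintegral => //.
  by apply: integrable_sub => // x; exact: cvg_cst.
exact: integrable_sub.
Qed.

Lemma tent (w : R) : 0 < w -> exists2 phi : R -> R,
  (forall x y, `|phi x - phi y| <= w^-1 * normc (1 - cis (x - y))) &
  [/\ forall x, 0 <= phi x <= 1, forall x, K x -> phi (a^-1 * x) = 1 &
      forall x, ~ chord_nbhd a K w x -> phi (a^-1 * x) = 0].
Proof.
move=> w0.
have [y0 Ky0] : K !=set0.
  by apply/set0P/eqP => K00; move: K0; rewrite K00 measure0 ltxx.
pose D x := [set normc (1 - cis (x - a^-1 * y)) | y in K].
have lbD x : lbound (D x) 0 by move=> _ [y _ <-]; exact: normc_ge0.
have hlbD x : has_lbound (D x) by exists 0; exact: lbD.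
have D0 x : D x !=set0 by exists (normc (1 - cis (x - a^-1 * y0))), y0.
pose d x := inf (D x).
have dlip x y : d x <= normc (1 - cis (x - y)) + d y.
  rewrite -lerBlDl; apply: lb_le_inf => // _ [z Kz <-].
  rewrite lerBlDl; apply: le_trans (chord_triangle _ y _).
  by apply: ge_inf => //; exists z.
have d0 x : 0 <= d x by exact: lb_le_inf.
pose phi x := Num.max 0 (1 - d x / w).
have half x y : phi x <= phi y + w^-1 * normc (1 - cis (x - y)).
  rewrite /phi ge_max; apply/andP; split.
    by rewrite addr_ge0 ?le_max ?lexx// mulr_ge0 ?normc_ge0// invr_ge0 ltW.
  apply: (@le_trans _ _ (1 - d y / w + w^-1 * normc (1 - cis (x - y)))); last first.
    by rewrite lerD2r le_max lexx orbT.
  have : w^-1 * d y <= w^-1 * (normc (1 - cis (y - x)) + d x).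
    by rewrite ler_pM2l ?invr_gt0.
  rewrite chord_sym; lra.
exists phi.
  move=> x y; rewrite ler_norml; apply/andP; split.
    by have := half y x; rewrite chord_sym; lra.
  by have := half x y; lra.
split => [x|x Kx|x nx].
- by rewrite le_max lexx/= ge_max ler01/= gerBl divr_ge0// ltW.
- rewrite /phi; have -> : d (a^-1 * x) = 0.
    apply/eqP; rewrite eq_le d0 andbT; apply: ge_inf => //.
    by exists x => //; rewrite subrr cis0 subrr normc0.
  by rewrite mul0r subr0; apply/max_idPr.
- apply/max_idPl; rewrite subr_le0 ler_pdivlMr// mul1r.
  apply: lb_le_inf => // _ [y Ky <-]; rewrite leNgt; apply/negP => h.
  by apply: nx; exists y.
Qed.

(* [Q = (1 + l (A - A(0)) / N) ^ N] approximates [exp (l (A - A(0)))], and its modulus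
   [exp (l (Re A - Re A(0)))] where [Re A] approximates the indicator of [K]. *)
Lemma small_outside (eta : R) : 0 < eta -> exists2 Q : {poly R[i]}, Q`_0 = 1 &
  \int[mu]_(x in U) normc Q.[cis (a^-1 * x)] <= eta.
Proof.
move=> eta0.
have [finK /andP[muK0 muKa]] := finS mK Ka.
have muKpos : 0 < fine (mu K) by rewrite -lte_fin fineK.
pose del := fine (mu K) / a.
have del0 : 0 < del by rewrite divr_gt0.
have del1 : del <= 1 by rewrite ler_pdivrMr// mul1r.
(* Off the neighbourhood of [K] the exponent is at most [1 - lam * (3 / 4 * del)]; this [lam] brings
   the exponential down to [eta / (2 * a)]. *)
pose lam := 4 / (3 * del) * `|1 - ln (eta / (2 * a))|.
have lam0 : 0 <= lam by rewrite mulr_ge0// divr_ge0// mulr_ge0// ltW.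
have exp_small : expR (1 - lam * (3 / 4 * del)) <= eta / (2 * a).
  have -> : lam * (3 / 4 * del) = `|1 - ln (eta / (2 * a))|.
    by rewrite /lam; field; rewrite gt_eqF.
  have e2a : 0 < eta / (2 * a) by rewrite divr_gt0// mulr_gt0.
  rewrite -[leRHS](@lnK R) ?posrE// ler_expR.
  by have := ler_norm (1 - ln (eta / (2 * a))); lra.
(* On the shell only [normc Q <= expR (1 + 2 * lam)] is known, so its measure must be small enough
   for a contribution of [eta / 2]. *)
pose kap := eta / (2 * expR (1 + 2 * lam)).
have kap0 : 0 < kap by rewrite divr_gt0// mulr_gt0// expR_gt0.
have [w w0 shell] := chord_shell_small a0 cK Ka kap0.
have [phi lip [phi01 phiK phi0]] := tent w0.
have wV : 0 <= w^-1 by rewrite invr_ge0 ltW.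
have del8 : 0 < del / 8 by rewrite divr_gt0.
have [A hA] := trig_approx wV lip del8.
pose T x := Re A.[cis (a^-1 * x)].
have cT : continuous T by exact: continuous_Re_horner.
have Tphi x : `|T x - phi (a^-1 * x)| <= del / 8 by exact: hA.
pose m := Re A`_0.
have UI : U `<=` `[0, a] by move=> x [].
have [finU /andP[muU0 muUa]] := finS mU UI.
have sumKU : fine (mu K) + fine (mu U) = a.
  rewrite -fineD// -measureU//; last by rewrite /U setDE setICA setICr setI0.
  by rewrite -itvKU [X in fine X]fin_itv.
(* The mean of [T] over [[0, a]] is [m]; it is at least [(1 - del / 8) del - (del / 8) (1 - del)],
   which equals [7 / 8 * del]. *)
have m_ge : 7 / 8 * del <= m.
  have aE : a * m = \int[mu]_(x in `[0, a]) T x by rewrite Rintegral_Re_horner.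
  have sp : \int[mu]_(x in `[0, a]) T x =
      \int[mu]_(x in K) T x + \int[mu]_(x in U) T x.
    rewrite itvKU Rintegral_setU//.
      by rewrite -itvKU; exact: integrable_continuous_itv.
    by apply/disj_setPS => x [Kx [_]].
  have h1 : (1 - del / 8) * fine (mu K) <= \int[mu]_(x in K) T x.
    apply: ge_Rintegral_cst => // x Kx.
    by apply: near1_ge; have := Tphi x; rewrite phiK.
  have h2 : (- (del / 8)) * fine (mu U) <= \int[mu]_(x in U) T x.
    apply: ge_Rintegral_cst => // x Ux.
    exact: near_ge0 (Tphi x) (phi01 _).
  have Ka' : fine (mu K) = del * a by rewrite /del mulfVK// gt_eqF.
  rewrite -(ler_pM2l a0) aE sp; apply: le_trans (lerD h1 h2).
  have -> : fine (mu U) = a - fine (mu K) by rewrite -sumKU addrC addKr.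
  by rewrite Ka' le_eqVlt; apply/orP; left; apply/eqP; field.
pose B : {poly R[i]} := (lam%:C)%C *: (A - (A`_0)%:P).
pose M := \sum_(i < size B) normc B`_i.
have M0 : 0 <= M by apply: sumr_ge0 => i _; exact: normc_ge0.
(* With [M ^+ 2 <= N] the quadratic error in [normc_pow_le_exp] is at most 1. *)
pose N := (Num.trunc (M ^+ 2)).+1.
have N0 : 0 < N%:R :> R by rewrite ltr0n.
pose Q : {poly R[i]} := (1 + B * (((N%:R^-1)%:C)%C)%:P) ^+ N.
have QE x : Q.[cis (a^-1 * x)] =
    (1 + B.[cis (a^-1 * x)] * ((N%:R^-1)%:C)%C) ^+ N.
  by rewrite /Q horner_exp !hornerE.
have Qle x : normc Q.[cis (a^-1 * x)] <= expR (lam * (T x - m) + 1).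
  rewrite QE; apply: le_trans (normc_pow_le_exp _ _) _ => //.
  rewrite ler_expR; apply: lerD.
    by rewrite /B hornerZ hornerD hornerN hornerC ReCM /= mul0r subr0 ReCB.
  rewrite ler_pdivrMr ?mulr_gt0// mul1r.
  have bM : normc B.[cis (a^-1 * x)] <= M by exact: normc_horner_cis.
  apply: (@le_trans _ _ (M ^+ 2)); first by rewrite lerXn2r ?nnegrE ?normc_ge0.
  apply: (@le_trans _ _ N%:R); first exact/ltW/truncnS_gt.
  by rewrite ler_peMl ?ltW// ltr1n.
exists Q.
  have Bz : B.[0] = 0.
    by rewrite /B hornerZ hornerD hornerN hornerC horner_coef0 subrr mulr0.
  by rewrite -horner_coef0 /Q horner_exp hornerD hornerM Bz mul0r addr0 -polyC1 hornerC expr1n.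
pose D := chord_nbhd a K w.
have mD : measurable D by apply: open_measurable; exact: open_chord_nbhd.
have mUD : measurable (U `\` D) by exact: measurableD.
have mUI : measurable (U `&` D) by exact: measurableI.
have cQ : continuous (fun x => normc Q.[cis (a^-1 * x)]).
  exact: continuous_normc_horner.
have spl : (U `\` D) `|` (U `&` D) = U by rewrite setUC setUIDK.
have -> : \int[mu]_(x in U) normc Q.[cis (a^-1 * x)] =
   \int[mu]_(x in U `\` D) normc Q.[cis (a^-1 * x)] +
   \int[mu]_(x in U `&` D) normc Q.[cis (a^-1 * x)].
  rewrite -{1}spl Rintegral_setU//; first by rewrite spl; exact: integrable_sub.
  by apply/disj_setPS => x [[_ nD] [_ Dx]].
have UDI : U `\` D `<=` `[0, a] by move=> x [/UI].
have UII : U `&` D `<=` `[0, a] by move=> x [/UI].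
have h1 : \int[mu]_(x in U `\` D) normc Q.[cis (a^-1 * x)] <=
    eta / (2 * a) * fine (mu (U `\` D)).
  apply: le_Rintegral_cst => // x [Ux nD].
  apply: le_trans (Qle x) _; apply: le_trans exp_small.
  rewrite ler_expR addrC lerD2l lerNr -mulrN ler_wpM2l//.
  by apply: near0_gap m_ge; have := Tphi x; rewrite phi0.
have h2 : \int[mu]_(x in U `&` D) normc Q.[cis (a^-1 * x)] <=
    expR (1 + 2 * lam) * fine (mu (U `&` D)).
  apply: le_Rintegral_cst => // x _.
  apply: le_trans (Qle x) _; rewrite ler_expR addrC lerD2l mulrC ler_wpM2r//.
  exact: near_le2 (Tphi x) (phi01 _) del0 del1 m_ge.
have [fUD /andP[UD0 UDa]] := finS mUD UDI.
have [fUI _] := finS mUI UII.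
have kUI : fine (mu (U `&` D)) <= kap by rewrite -lee_fin fineK// ltW.
apply: le_trans (lerD h1 h2) _; rewrite [leRHS]splitr; apply: lerD.
  apply: (@le_trans _ _ (eta / (2 * a) * a)); last first.
    by rewrite invfM mulrA mulfVK// gt_eqF.
  by rewrite ler_wpM2l// divr_ge0 ?mulr_ge0// ltW.
apply: (@le_trans _ _ (expR (1 + 2 * lam) * kap)).
  by rewrite ler_wpM2l// expR_ge0.
by rewrite /kap invfM [eta * _]mulrA mulrC mulfVK// gt_eqF// expR_gt0.
Qed.

(** As [Q(0) = 1], the product [p * Q] has the constant coefficient of [p], and this is its mean
    over the circle. On [K] the factor [p] is small, elsewhere the integral of [normc Q] is. *)
Lemma first_coef_small (M eta : R) : 0 < M -> 0 < eta ->
  exists2 eps : R, 0 < eps & forall p : {poly R[i]},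
    (forall x, normc p.[cis x] <= M) ->
    (forall x, K x -> normc p.[cis (a^-1 * x)] <= eps) -> normc p`_0 <= eta.
Proof.
move=> M0 eta0.
have e1 : 0 < a * eta / (2 * M) by rewrite divr_gt0 ?mulr_gt0.
have [Q Q0 hQ] := small_outside e1.
pose B := \sum_(i < size Q) normc Q`_i + 1.
have B0 : 0 < B by rewrite ltr_wpDl// sumr_ge0// => i _; exact: normc_ge0.
have QB x : normc Q.[cis x] <= B.
  by apply: le_trans (normc_horner_cis _ _) _; rewrite lerDl.
exists (eta / (2 * B)); first by rewrite divr_gt0// mulr_gt0.
move=> p pM pK.
have [c c1 cp] := normc_phase p`_0.
pose g : {poly R[i]} := c *: (p * Q).
have g0 : g`_0 = c * p`_0.
  by rewrite -[LHS]horner_coef0 /g hornerZ hornerM !horner_coef0 Q0 mulr1.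
have gE : a * normc p`_0 = \int[mu]_(x in `[0, a]) Re g.[cis (a^-1 * x)].
  by rewrite Rintegral_Re_horner// g0 cp.
have cg : continuous (fun x => Re g.[cis (a^-1 * x)]) by exact: continuous_Re_horner.
have cQ : continuous (fun x => normc Q.[cis (a^-1 * x)]).
  exact: continuous_normc_horner.
have gle x : Re g.[cis (a^-1 * x)] <=
    normc p.[cis (a^-1 * x)] * normc Q.[cis (a^-1 * x)].
  apply: le_trans (Re_le_normc _) _.
  by rewrite /g hornerZ hornerM !normcM c1 mul1r.
have UI : U `<=` `[0, a] by move=> x [].
have [finK /andP[muK0 muKa]] := finS mK Ka.
have sp : \int[mu]_(x in `[0, a]) Re g.[cis (a^-1 * x)] =
    \int[mu]_(x in K) Re g.[cis (a^-1 * x)] +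
    \int[mu]_(x in U) Re g.[cis (a^-1 * x)].
  rewrite itvKU Rintegral_setU//.
    by rewrite -itvKU; exact: integrable_continuous_itv.
  by apply/disj_setPS => x [Kx [_]].
have h1 : \int[mu]_(x in K) Re g.[cis (a^-1 * x)] <= eta / 2 * fine (mu K).
  apply: le_Rintegral_cst => // x Kx; apply: le_trans (gle x) _.
  apply: (@le_trans _ _ (eta / (2 * B) * B)); last first.
    by rewrite invfM mulrA mulfVK// gt_eqF.
  by apply: ler_pM; rewrite ?normc_ge0// pK.
have h2 : \int[mu]_(x in U) Re g.[cis (a^-1 * x)] <= M * (a * eta / (2 * M)).
  apply: (@le_trans _ _ (\int[mu]_(x in U) (M * normc Q.[cis (a^-1 * x)]))).
    apply: le_Rintegral => //; first exact: integrable_sub.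
      apply: integrable_sub => // x.
      by apply: cvgM; [exact: cvg_cst|exact: cQ].
    move=> x _; apply: le_trans (gle x) _.
    by rewrite ler_wpM2r ?normc_ge0.
  rewrite RintegralZl//; last exact: integrable_sub.
  by rewrite ler_wpM2l// ltW.
rewrite -(ler_pM2l a0) gE sp; apply: le_trans (lerD h1 h2) _.
have -> : M * (a * eta / (2 * M)) = a * eta / 2 by field; rewrite gt_eqF.
have : eta / 2 * fine (mu K) <= eta / 2 * a by rewrite ler_wpM2l// ltW// divr_gt0.
lra.
Qed.

(* Peel off the constant coefficient, which is small, and divide by the variable. *)
Lemma coef_small (M : R) (k : nat) (eta : R) : 0 < M -> 0 < eta ->
  exists2 eps : R, 0 < eps & forall p : {poly R[i]},
    (forall x, normc p.[cis x] <= M) ->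
    (forall x, K x -> normc p.[cis (a^-1 * x)] <= eps) -> normc p`_k <= eta.
Proof.
elim: k M eta => [|k IH] M eta M0 eta0; first exact: first_coef_small.
have M2 : 0 < 2 * M by rewrite mulr_gt0.
have [e e0 he] := IH (2 * M) eta M2 eta0.
(* With [p(0)] below both numbers, [p - p(0)] is bounded by [2 * M] everywhere and by [e] on [K], as
   the induction hypothesis requires. *)
have e20 : 0 < Num.min M (e / 2) by rewrite lt_min M0 divr_gt0.
have [e' e'0 he'] := first_coef_small M0 e20.
exists (Num.min e' (e / 2)); first by rewrite lt_min e'0 divr_gt0.
move=> p pM pK.
have p0 : normc p`_0 <= Num.min M (e / 2).
  apply: he' => // x Kx; apply: le_trans (pK x Kx) _.
  by rewrite ge_min lexx.
move: p0; rewrite le_min => /andP[p0M p0e].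
pose r := drop_poly 1 p.
have rE x : normc r.[cis x] = normc (p.[cis x] - p`_0).
  have -> : p.[cis x] - p`_0 = r.[cis x] * cis x.
    rewrite -{1}(poly_take_drop 1 p) hornerD hornerM hornerXn expr1.
    have -> : take_poly 1 p = (p`_0)%:P.
      by apply/polyP => -[|i]; rewrite coef_take_poly coefC.
    by rewrite hornerC addrC addKr.
  by rewrite normcM normc_cis mulr1.
have -> : p`_k.+1 = r`_k by rewrite coef_drop_poly addn1.
apply: he => [x|x Kx]; rewrite rE; apply: le_trans (le_normcD _ _) _; rewrite normcN.
  by have := pM x; lra.
have : normc p.[cis (a^-1 * x)] <= e / 2.
  by apply: le_trans (pK x Kx) _; rewrite ge_min lexx orbT.
lra.
Qed.

End SmallOutside.

(** * Compact sets avoiding the spectrum *)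

Section CompactGap.
Context {R : realType}.
Notation mu := (@lebesgue_measure R).

(** The outer measure provides a measurable [V] containing [G] with measure below [a]; the rest of
    [[0, a]] has positive measure, and inner regularity gives [K] inside it. *)
Lemma compact_avoiding (G : set R) (a : R) : 0 < a -> (leb G < a%:E)%E ->
  exists K : set R, [/\ compact K, K `<=` `[0, a], (0%:E < mu K)%E &
    forall x, K x -> ~ G x].
Proof.
move=> a0 Ga.
have [V [mV GV Va]] : exists V : set R, [/\ measurable V, G `<=` V & (mu V < a%:E)%E].
  have /ereal_inf_lt[_ [A [mA GA] <-] lt] : (leb G < a%:E)%E := Ga.
  exists (\bigcup_k A k); split => //.
    apply: bigcupT_measurable => k; apply: sub_sigma_algebra; exact: mA.
  apply: le_lt_trans lt; apply: ereal_inf_lbound.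
  by exists A => //; split.
pose J : set R := `[0, a]%classic.
pose E : set R := J `\` V.
have mE : measurable E by apply: measurableD => //; exact: measurable_itv.
have itvE : mu J = a%:E.
  by rewrite lebesgue_measure_itv/= lte_fin a0 -EFinB subr0.
have Efin : (mu E < +oo)%E.
  apply: (@le_lt_trans _ _ (mu J)); last by rewrite itvE ltry.
  by apply: le_measure; [rewrite inE|rewrite inE; exact: measurable_itv|move=> x []].
have E0 : (0%:E < mu E)%E.
  rewrite ltNge; apply/negP => E0.
  have : (mu J <= mu V + mu E)%E.
    apply: (@le_trans _ _ (mu (V `|` E))); last exact: outer_measureU2.
    apply: le_measure.
    - by rewrite inE; exact: measurable_itv.
    - by rewrite inE; exact: measurableU.
    - by move=> x Ix; have [Vx|nVx] := pselect (V x); [left|right].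
  rewrite itvE leNgt => /negP; apply.
  by apply: le_lt_trans Va; rewrite -[leRHS]adde0 leeD2l.
have fE : mu E \is a fin_num by rewrite ge0_fin_numE.
have E0' : 0 < fine (mu E) by rewrite -lte_fin fineK.
(* The tolerance is the whole measure of [E], which suffices to exclude that [K] is null. *)
have [K [cK KE lt]] := lebesgue_regularity_inner mE Efin E0'.
have mK : measurable K.
  by apply: closed_measurable; apply: compact_closed => //; exact: Rhausdorff.
exists K; split => //.
- by move=> x /KE[].
- rewrite ltNge; apply/negP => K0.
  move: lt; rewrite fineK// ltNge => /negP; apply.
  have : (mu E <= mu K + mu (E `\` K))%E.
    apply: (@le_trans _ _ (mu (K `|` (E `\` K)))); last exact: outer_measureU2.
    apply: le_measure; rewrite ?inE//.
    + by apply: measurableU => //; exact: measurableD.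
    + by rewrite setDUK.
  move=> /le_trans; apply; rewrite -[leRHS]add0e; exact: leeD2r.
- by move=> x /KE[_ nV] /GV.
Qed.

End CompactGap.

(** * Uniform density *)

Lemma lez_pred_nat (m n : int) (k : nat) :
  (0 < k)%N -> m < n + k%:Z -> m <= n + k.-1%:Z.
Proof. lia. Qed.

Lemma subz1_succ (n : int) (k : nat) : n - 1 + k.+1%:Z = n + k%:Z.
Proof. lia. Qed.

Section Density.
Context {R : realType}.
Variables (a : R) (lambda : int -> R).
Hypothesis a0 : 0 < a.
Hypothesis step : forall n, lambda n + a^-1 <= lambda (n + 1).
Hypothesis spread : forall eps : R, 0 < eps -> exists2 C : R, 0 <= C & forall n (k : nat),
  lambda (n + k%:Z) - lambda n <= k%:R / a + C + eps * k%:R.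

Lemma lambda_gap n (k : nat) : lambda n + k%:R / a <= lambda (n + k%:Z).
Proof.
elim: k => [|k IH]; first by rewrite mul0r !addr0.
have -> : n + k.+1%:Z = n + k%:Z + 1 by rewrite -addrA -[k.+1]addn1 PoszD.
apply: le_trans (step _); rewrite -natr1 mulrDl mul1r addrA lerD2r.
exact: IH.
Qed.

Lemma lambda_lt m n : m < n -> lambda m + a^-1 <= lambda n.
Proof.
move=> mn; have [k kE] : exists k : nat, n = m + k.+1%:Z.
  by exists (`|n - m|.-1)%N; lia.
rewrite kE; apply: le_trans (lambda_gap _ _); rewrite lerD2l.
by rewrite -[leLHS]mul1r ler_pM2r ?invr_gt0// ler1n.
Qed.

Lemma lambda_uniformly_discrete : uniformly_discrete (range lambda).
Proof.
exists a^-1; split; first by rewrite invr_gt0.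
move=> _ _ [m _ <-] [n _ <-] mn.
have : m != n by apply: contra mn => /eqP ->.
have ai : 0 < a^-1 by rewrite invr_gt0.
case: (ltgtP m n) => // h _.
  by have := lambda_lt h; have := ler_norm (lambda n - lambda m); rewrite distrC; lra.
by have := lambda_lt h; have := ler_norm (lambda m - lambda n); lra.
Qed.

(** The minimal gap [1 / a] bounds the number of points in the interval from above, and [spread],
    applied to a stretch that covers the interval, from below. *)
Lemma lambda_density : has_uniform_density (range lambda) a.
Proof.
move=> eps eps0.
have ai : 0 < a^-1 by rewrite invr_gt0.
pose e := eps / (4 * a ^+ 2).
have e0 : 0 < e by rewrite divr_gt0// mulr_gt0// exprn_gt0.
have [C C0 hC] := spread e0.
pose r0 := a^-1 + (1 + a * C + a * e) * 2 / eps.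
have aC : 0 <= a * C by rewrite mulr_ge0// ltW.
have aepos : 0 < a * e by rewrite mulr_gt0.
have q0 : 0 <= (1 + a * C + a * e) * 2 / eps.
  apply: divr_ge0; last exact: ltW.
  apply: mulr_ge0 => //; lra.
have r00 : 0 < r0 by rewrite ltr_wpDr.
exists r0; split => // r x r0r.
have [n0 hn0] : exists n0 : int, lambda n0 <= x.
  pose k := (Num.trunc (a * (lambda 0 - x))).+1.
  have hk : a * (lambda 0 - x) < k%:R by exact: truncnS_gt.
  exists (- k%:Z).
  have := lambda_gap (- k%:Z) k; rewrite addNr.
  have : lambda 0 - x <= k%:R / a by rewrite ler_pdivlMr// mulrC ltW.
  lra.
have unbd n y : exists k : nat, y <= lambda (n + k%:Z).
  pose k := (Num.trunc (a * (y - lambda n))).+1.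
  have hk : a * (y - lambda n) < k%:R by exact: truncnS_gt.
  exists k; have := lambda_gap n k.
  have : y - lambda n <= k%:R / a by rewrite ler_pdivlMr// mulrC ltW.
  lra.
have exA : exists k : nat, x < lambda (n0 + k%:Z).
  have [k hk] := unbd n0 (x + 1); exists k; apply: lt_le_trans hk; lra.
(* [A] is the first index with [lambda A > x], and [k2] below is the number of points in the
   interval. *)
have [k1 hk1 mink1] := ex_minnP exA.
pose A := n0 + k1%:Z.
have [k2 hk2 mink2] := ex_minnP (unbd A (x + r)).
have lt_mono m n : m < n -> lambda m < lambda n.
  by move=> /lambda_lt; lra.
have le_mono m n : m <= n -> lambda m <= lambda n.
  by rewrite le_eqVlt => /orP[/eqP ->//|/lt_mono/ltW].
have inj_lambda : injective lambda.
  by move=> m n mn; case: (ltgtP m n) => // /lt_mono; rewrite mn ltxx.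
have beforeA n : n < A -> lambda n <= x.
  move=> nA; have k10 : (0 < k1)%N.
    by rewrite lt0n; apply/eqP => k10; move: hk1; rewrite k10 addr0 ltNge hn0.
  apply: (@le_trans _ _ (lambda (n0 + k1.-1%:Z))); first by apply: le_mono; exact: lez_pred_nat.
  by rewrite leNgt; apply/negP => /mink1; rewrite -ltnS prednK// ltnn.
have beforeB (i : nat) : (i < k2)%N -> lambda (A + i%:Z) < x + r.
  move=> ik; by rewrite ltNge; apply/negP => /mink2; rewrite leqNgt ik.
exists [seq lambda (A + i%:Z) | i <- iota 0 k2]; split; [|split].
- by rewrite map_inj_uniq ?iota_uniq// => i j /inj_lambda/addrI [].
- apply/seteqP; split => y /=.
    move=> /mapP[j]; rewrite mem_iota add0n => /andP[_ jk] ->; split.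
      by exists (A + j%:Z).
    rewrite beforeB// andbT; by apply: lt_le_trans hk1 _; apply: le_mono; rewrite -/A lerDl.
  move=> [[n _ <-] /andP[xn nr]].
  have An : A <= n by rewrite leNgt; apply/negP => /beforeA; rewrite leNgt xn.
  have nE : n = A + (`|n - A|%N)%:Z by rewrite gez0_abs ?subr_ge0// [RHS]addrC subrK.
  apply/mapP; exists `|n - A|%N; last by rewrite -nE.
  rewrite mem_iota add0n /= ltnNge; apply/negP => hk.
  have : lambda (A + k2%:Z) <= lambda n by apply: le_mono; rewrite nE lerD2l lez_nat.
  lra.
rewrite size_map size_iota.
have up : k2%:R <= r * a + 1.
  case: (posnP k2) => [->|k20].
    by rewrite addr_ge0// mulr_ge0// ltW// (lt_le_trans r00).
  have := lambda_gap A k2.-1; have := beforeB k2.-1; rewrite prednK// => /(_ (leqnn _)).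
  have := hk1; rewrite -/A => h1 h2 h3.
  have : k2.-1%:R / a <= r by lra.
  rewrite ler_pdivrMr//.
  have -> : k2.-1%:R = k2%:R - 1 :> R by rewrite -subn1 natrB.
  lra.
(* From [A - 1], still at most [x], to [A + k2], already at least [x + r], there are [k2 + 1]
   steps. *)
have lo : r <= (k2%:R + 1) / a + C + e * (k2%:R + 1).
  have := hC (A - 1) k2.+1; rewrite subz1_succ.
  have : lambda (A - 1) <= x by apply: beforeA; rewrite gtrBl.
  rewrite -[k2.+1%:R]natr1; lra.
have lo' : r * a <= k2%:R + 1 + a * C + a * e * (k2%:R + 1).
  have := ler_wpM2l (ltW a0) lo; rewrite mulrC => /le_trans; apply.
  rewrite le_eqVlt; apply/orP; left; apply/eqP; field; exact: lt0r_neq0.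
have r1 : 1 <= r * a.
  apply: (@le_trans _ _ (r0 * a)); last by rewrite ler_pM2r.
  by rewrite /r0 mulrDl mulVf ?gt_eqF// lerDl mulr_ge0// ltW.
have epsr : (1 + a * C + a * e) * 2 <= eps * r.
  rewrite mulrC [eps * r]mulrC -ler_pdivrMr// mulrC; apply: le_trans r0r.
  by rewrite /r0 lerDr ltW.
have ae : a * e * (r * a) = eps * r / 4.
  by rewrite /e; field; exact: lt0r_neq0.
have ae2 : a * e * (k2%:R + 1) <= a * e * (r * a + 2).
  by apply: ler_wpM2l; [exact: ltW|lra].
have ae3 : a * e <= eps * r / 4.
  by rewrite -ae ler_peMr// ltW.
rewrite ler_norml; apply/andP; split; lra.
Qed.

End Density.

(** * The uniqueness set *)

Section Stages.
Context {R : realType}.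
Variables (a : R) (p : nat -> nat).
Hypotheses (a0 : 0 < a) (p0 : p 0 = 0%N) (pS : forall m, (p m < p m.+1)%N).

(** The number of the block from [p m] to [p m.+1] containing [n], written as a counter so that it
    visibly grows by at most one per step. *)
Fixpoint stage (n : nat) : nat :=
  if n is n'.+1 then
    if n == p (stage n').+1 then (stage n').+1 else stage n'
  else 0.

Lemma p_mono m n : (m < n)%N -> (p m < p n)%N.
Proof.
elim: n => // n IH; rewrite ltnS leq_eqVlt => /orP[/eqP ->//|/IH h].
exact: ltn_trans (pS n).
Qed.

Lemma p_ge m : (m <= p m)%N.
Proof. by elim: m => // m IH; exact: leq_ltn_trans (pS m). Qed.

Lemma stageP n : (p (stage n) <= n < p (stage n).+1)%N.
Proof.
elim: n => [|n /andP[IH1 IH2]] /=; first by rewrite p0 leqnn -{1}p0 pS.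
case: eqP => [e|/eqP ne]; first by rewrite -e leqnn e pS.
by rewrite ltn_neqAle ne (leqW IH1).
Qed.

Lemma stageE m n : (p m <= n < p m.+1)%N -> stage n = m.
Proof.
move=> /andP[h1 h2]; have /andP[s1 s2] := stageP n.
case: (ltngtP (stage n) m) => // h; exfalso.
  have : (p (stage n).+1 <= p m)%N.
    by move: h; rewrite leq_eqVlt => /orP[/eqP ->//|/p_mono/ltnW].
  by move=> /leq_trans /(_ h1); rewrite leqNgt s2.
have : (p m.+1 <= p (stage n))%N.
  by move: h; rewrite leq_eqVlt => /orP[/eqP ->//|/p_mono/ltnW].
by move=> /leq_trans /(_ s1); rewrite leqNgt h2.
Qed.

Definition drift (m : nat) : R := a^-1 * series harmonic m.

Lemma drift0 : drift 0 = 0. Proof. by rewrite /drift /series /= big_geq// mulr0. Qed.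

Lemma driftS m : drift m.+1 = drift m + (a * m.+1%:R)^-1.
Proof. by rewrite /drift /series /= big_nat_recr//= mulrDr invfM. Qed.

Lemma drift_step_gt0 m : 0 < (a * m.+1%:R)^-1.
Proof. by rewrite invr_gt0 mulr_gt0. Qed.

Lemma drift_le m n : (m <= n)%N -> drift m <= drift n.
Proof.
elim: n => [|n IH]; first by rewrite leqn0 => /eqP ->.
rewrite leq_eqVlt ltnS => /orP[/eqP ->//|/IH /le_trans]; apply.
by rewrite driftS lerDl ltW// drift_step_gt0.
Qed.

Lemma drift_ge0 m : 0 <= drift m.
Proof. by rewrite -drift0; exact: drift_le. Qed.

(** Each step of [a * drift] is at most 1. With [p_ge] this gives [a * drift m <= p m], so the shift
    is negligible against the gap that follows. *)
Lemma drift_le_lin m : a * drift m <= m%:R.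
Proof.
elim: m => [|m IH]; first by rewrite drift0 mulr0.
have e : a * (a * m.+1%:R)^-1 = m.+1%:R^-1.
  by rewrite invfM mulrA divff ?gt_eqF// mul1r.
rewrite driftS mulrDr e -[leRHS]natr1.
by apply: lerD => //; rewrite invf_le1 ?ler1n.
Qed.

Lemma drift_unbounded (y : R) : exists m, y < drift m.
Proof.
apply: contrapT => /forallNP h; apply: (@dvg_harmonic R).
apply: nondecreasing_is_cvgn.
  apply/nondecreasing_seqP => n; rewrite /series /= big_nat_recr//= lerDl.
  by rewrite /harmonic invr_ge0.
exists (a * y) => _ [n _ <-].
rewrite leNgt; apply/negP => hn; apply: (h n).
by rewrite /drift -ltr_pdivrMl ?invr_gt0// invrK.
Qed.

(* The steps of [drift] tend to [0] and its values to infinity, hence its values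
   modulo [1 / a] accumulate at every point. *)
Lemma drift_dense (x delta : R) (N : nat) : 0 < delta ->
  exists m k : nat, (N <= m)%N /\ 0 < drift m - (x + k%:R / a) < delta.
Proof.
move=> d0; pose N1 := maxn N (Num.trunc (a * delta)^-1).
have [k hk] : exists k : nat, drift N1 < x + k%:R / a.
  exists (Num.trunc (a * (drift N1 - x))).+1.
  by rewrite -ltrBlDl ltr_pdivlMr// mulrC truncnS_gt.
(* The first value of [drift] past the target overshoots it by at most its last step, and after [N1]
   the steps are below [delta]. *)
have [m hm minm] := ex_minnP (drift_unbounded (x + k%:R / a)).
have Nm : (N1 < m)%N.
  rewrite ltnNge; apply/negP => /drift_le.
  by rewrite leNgt (lt_trans hk hm).
case: m hm minm Nm => // m hm minm Nm.
exists m.+1, k; split; first by rewrite (leq_trans (leq_maxl _ _) (ltnW Nm)).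
rewrite subr_gt0 hm /= driftS.
have le : drift m <= x + k%:R / a.
  by rewrite leNgt; apply/negP => /minm; rewrite ltnn.
suff : (a * m.+1%:R)^-1 < delta.
  by move: ((a * _)^-1) (x + _) le => w y; lra.
rewrite invf_plt ?posrE ?mulr_gt0//.
have : (a * delta)^-1 < m.+1%:R.
  apply: lt_le_trans (truncnS_gt _) _; rewrite ler_nat.
  by apply: leq_trans Nm; rewrite ltnS leq_maxr.
by rewrite invfM -[X in _ * X < _]/(delta^-1) ltr_pdivrMl.
Qed.

Definition node (n : int) : R :=
  n%:~R / a + (if n is Posz n' then drift (stage n') else 0).

Lemma node_nat (n : nat) : node n%:Z = n%:R / a + drift (stage n).
Proof. by []. Qed.

Lemma stage_step n : stage n.+1 = stage n \/ stage n.+1 = (stage n).+1.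
Proof. by rewrite /=; case: ifP; [right|left]. Qed.

Lemma node_step n : node n + a^-1 <= node (n + 1).
Proof.
rewrite /node intrD mulrDl mul1r [leLHS]addrAC lerD2l.
case: n => [n|[|n]].
- rewrite -[Posz n + 1]/(Posz (n + 1)%N) addn1; apply: drift_le.
  by case: (stage_step n) => ->.
- exact: drift_ge0.
- by have -> : Negz n.+1 + 1 = Negz n by lia.
Qed.

(** From stage [M] on every step is at most [eps], and up to then the drift stays below the constant
    [drift M]; the maximum in [H] carries both cases through the induction. *)
Lemma drift_spread (eps : R) : 0 < eps -> exists2 C : R, 0 <= C & forall n k : nat,
  drift (stage (n + k)) - drift (stage n) <= C + eps * k%:R.
Proof.
move=> e0; pose M := Num.trunc (a * eps)^-1.
exists (drift M); first exact: drift_ge0.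
move=> n k.
have H : drift (stage (n + k)) <= Num.max (drift (stage n)) (drift M) + eps * k%:R.
  elim: k => [|k IH]; first by rewrite addn0 mulr0 addr0 le_max lexx.
  rewrite addnS; case: (stage_step (n + k)) => ->.
    by apply: le_trans IH _; rewrite lerD2l ler_pM2l// ler_nat.
  have [Mm|mM] := leqP M (stage (n + k)).
    have -> : eps * k.+1%:R = eps * k%:R + eps by rewrite -natr1 mulrDr mulr1.
    rewrite driftS addrA; apply: lerD => //.
    rewrite invf_ple ?posrE ?mulr_gt0//.
    have : (a * eps)^-1 < (stage (n + k)).+1%:R.
      by apply: lt_le_trans (truncnS_gt _) _; rewrite ler_nat ltnS.
    by rewrite invfM ltr_pdivrMl// => /ltW.
  apply: (@le_trans _ _ (drift M)); first exact: drift_le.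
  apply: ler_wpDr; first by rewrite mulr_ge0// ltW.
  by rewrite le_max lexx orbT.
have : Num.max (drift (stage n)) (drift M) <= drift (stage n) + drift M.
  by rewrite ge_max lerDl lerDr !drift_ge0.
move: H; lra.
Qed.

Lemma node_spread (eps : R) : 0 < eps -> exists2 C : R, 0 <= C & forall n (k : nat),
  node (n + k%:Z) - node n <= k%:R / a + C + eps * k%:R.
Proof.
move=> e0; have [C C0 hC] := drift_spread e0; exists C => // n k.
pose s (n : int) := if n is Posz n' then drift (stage n') else 0.
suff : s (n + k%:Z) - s n <= C + eps * k%:R.
  by rewrite /node -/(s n) -/(s (n + k%:Z)) intrD mulrDl -pmulrn; lra.
case: n => [n|n] /=; first exact: hC.
rewrite subr0; case E : (Negz n + k%:Z) => [i|i] /=; last first.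
  by rewrite addr_ge0// mulr_ge0// ltW.
have ik : (i <= k)%N by move: E; rewrite NegzE; lia.
have := hC 0%N i; rewrite add0n /= drift0 subr0 => /le_trans; apply.
by rewrite lerD2l ler_pM2l// ler_nat.
Qed.

End Stages.

(** * Choice of the gaps *)

Section NextStage.
Context {R : realType}.
Notation mu := (@lebesgue_measure R).
Variables (a : R) (K : set R).
Hypotheses (a0 : 0 < a) (cK : compact K) (Ka : K `<=` `[0, a]) (K0 : (0%:E < mu K)%E).

Lemma coef_small_upto (M : R) (N : nat) (eta : R) : 0 < M -> 0 < eta ->
  exists2 eps : R, 0 < eps & forall p : {poly R[i]},
    (forall x, normc p.[cis x] <= M) ->
    (forall x, K x -> normc p.[cis (a^-1 * x)] <= eps) ->
    forall k, (k < N)%N -> normc p`_k <= eta.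
Proof.
move=> M0 eta0; elim: N => [|N [e1 e10 h1]]; first by exists 1.
have [e2 e20 h2] := coef_small a0 cK Ka K0 N M0 eta0.
exists (Num.min e1 e2); first by rewrite lt_min e10.
move=> p pM pK k; rewrite ltnS leq_eqVlt => /orP[/eqP ->|kN].
  by apply: h2 => // x Kx; apply: le_trans (pK x Kx) _; rewrite ge_min lexx orbT.
by apply: h1 => // x Kx; apply: le_trans (pK x Kx) _; rewrite ge_min lexx.
Qed.

(** One sequence must serve all functions of the space, so the constants depending on the function
    are replaced by powers of [p.+1], which dominate them for large [p]. The range [4 * p] contains
    the indices [p.-1 + k] with [k <= 2 * p] used at the end. *)
Definition long_gap (p q : nat) := (p < q)%N /\ forall P : {poly R[i]},
  (forall x, normc P.[cis x] <= p.+1%:R ^+ 2) ->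
  (forall x, K x -> normc P.[cis (a^-1 * x)] <= p.+1%:R / q%:R) ->
  forall k, (k < 4 * p)%N -> normc P`_k <= p.+1%:R^-1.

Lemma exists_long_gap p : exists q, long_gap p q.
Proof.
have M0 : 0 < p.+1%:R ^+ 2 :> R by rewrite exprn_gt0.
have e0 : 0 < p.+1%:R^-1 :> R by rewrite invr_gt0.
have [eps eps0 h] := coef_small_upto (4 * p) M0 e0.
exists (maxn p.+1 (Num.trunc (p.+1%:R / eps)).+1); split; first by rewrite leq_maxl.
move=> P PM PK; apply: h => // x Kx; apply: le_trans (PK x Kx) _.
rewrite ler_pdivrMr ?ltr0n ?leq_max// mulrC -ler_pdivrMr//.
by apply: le_trans (ltW (truncnS_gt _)) _; rewrite ler_nat leq_maxr.
Qed.

End NextStage.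

Lemma pred_add_lt (n k : nat) : (0 < n)%N -> (k <= 2 * n)%N -> (n.-1 + k < 4 * n)%N.
Proof. lia. Qed.

Lemma lin_le_sqr (R : realType) (n c d : R) : 0 <= d -> 1 <= n -> 5 * c + d <= n ->
  5 * n * c + d <= (n + 1) ^+ 2.
Proof.
move=> d0 n1 h.
have nd : d <= n * d by rewrite ler_peMl.
have hn : n * (5 * c + d) <= n * n by apply: ler_wpM2l => //; lra.
have -> : (n + 1) ^+ 2 = n * n + 2 * n + 1 by ring.
lra.
Qed.

(** * Vanishing of a function that is zero on the nodes *)

Section Uniqueness.
Context {R : realType}.
Notation mu := (@lebesgue_measure R).
Variables (a : R) (K : set R) (p : nat -> nat).
Hypotheses (a0 : 0 < a) (p0 : p 0 = 0%N).
Hypothesis gap : forall m, long_gap a K (p m) (p m.+1).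
Variables (u v : R -> R) (C : R).
Hypotheses (cu : continuous u) (cv : continuous v).
Let f x : R[i] := (u x +i* v x)%C.
Hypothesis fC : forall x, normc (f x) <= C / (1 + x ^+ 2).
Hypothesis fourier0 : forall t, K t -> forall k : int,
  fourier_re u v (t + k%:~R * a) = 0 /\ fourier_im u v (t + k%:~R * a) = 0.
Hypothesis vanish : forall n, u (node a p n) = 0 /\ v (node a p n) = 0.

Let pS m : (p m < p m.+1)%N. Proof. by have [] := gap m. Qed.

Let C0 : 0 <= C. Proof. exact: decay_cst_ge0 fC. Qed.

(** The first [5 * p1] samples are bounded by [C] each; the following ones lie so far to the left
    that the quadratic decay applies despite the shift [x0]. *)
Lemma sample_sum_le (x0 : R) (p1 D : nat) : 0 <= x0 -> a * x0 <= p1%:R -> (0 < p1)%N ->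
  \sum_(j < D) normc (f (x0 + (p1%:R - 1 - j%:R) / a)) <=
    5 * p1%:R * C + 32 * a ^+ 2 * C.
Proof.
move=> x00 ax0 p10.
have p1R : 1 <= p1%:R :> R by rewrite ler1n.
have fle x : normc (f x) <= C.
  apply: le_trans (fC x) _.
  by rewrite ler_pdivrMr ?ltr_wpDr ?sqr_ge0// ler_peMr// lerDl sqr_ge0.
have c16 : 0 <= 16 * a ^+ 2 * C by rewrite !mulr_ge0// ltW.
set F := fun j : nat => normc (f (x0 + (p1%:R - 1 - j%:R) / a)).
rewrite -(big_mkord xpredT F).
apply: (@le_trans _ _ (\sum_(0 <= j < 5 * p1 + D) F j)).
  rewrite [leRHS](@big_cat_nat _ _ _ D)//=; last by rewrite leq_addl.
  by rewrite lerDl; apply: sumr_ge0 => j _; exact: normc_ge0.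
rewrite (@big_cat_nat _ _ _ (5 * p1)%N)//=; last by rewrite leq_addr.
apply: lerD.
  apply: (@le_trans _ _ (\sum_(0 <= j < 5 * p1) C)).
    by apply: ler_sum => j _; exact: fle.
  by rewrite sumr_const_nat subn0 -[C *+ _]mulr_natl natrM.
rewrite -{1}[(5 * p1)%N]add0n big_addn.
have -> : (5 * p1 + D - 5 * p1)%N = D by rewrite addnC addnK.
have -> : 32 * a ^+ 2 * C = 16 * a ^+ 2 * C * 2 by ring.
have q0 : (0 < 4 * p1 + 1)%N by rewrite addn1.
apply: (@le_trans _ _ (16 * a ^+ 2 * C * (2 / (4 * p1 + 1)%:R))); last first.
  rewrite ler_wpM2l// ler_pdivrMr ?ltr0n// ler_peMr// ler1n//.
apply: le_trans (ler_wpM2l c16 (@sum_inv_sqr_le R _ D q0)).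
rewrite mulr_sumr; apply: ler_sum => j _; apply: decay_le => //; first by rewrite addn1.
have -> : p1%:R - 1 - (j + 5 * p1)%:R = - ((4 * p1 + 1 + j)%:R : R).
  have -> : (j + 5 * p1)%:R = j%:R + 5 * p1%:R :> R by rewrite natrD natrM.
  have -> : (4 * p1 + 1 + j)%:R = 4 * p1%:R + 1 + j%:R :> R.
    by rewrite [LHS]natrD [X in X + _]natrD natrM.
  by ring.
have m4 : 4 * p1%:R <= (4 * p1 + 1 + j)%:R :> R.
  by rewrite -natrM ler_nat -addnA leq_addr.
move: (4 * p1 + 1 + j)%:R m4 => m m4.
have x0m : x0 <= m / a / 4.
  have : x0 * 4 <= m / a by rewrite ler_pdivlMr// -[_ * a]mulrA; lra.
  lra.
have := ler_norm (- (x0 + - m / a)); rewrite normrN mulNr.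
have : 0 <= m / a by rewrite divr_ge0// ?ltW//; lra.
lra.
Qed.

(** The samples before the gap, read from right to left, are the coefficients of [P]. On [K] the
    polynomial has the modulus of a sum controlled by [poisson_bound], because the samples in the
    gap are zero. *)
Lemma sample_small (m : nat) (k : nat) : (0 < m)%N ->
  5 * (p m)%:R * C + 32 * a ^+ 2 * C <= (p m).+1%:R ^+ 2 ->
  64 * a ^+ 2 * C <= (p m).+1%:R -> (k < 4 * p m)%N ->
  normc (f (drift a m + ((p m)%:R - 1 - k%:R) / a)) <= (p m).+1%:R^-1.
Proof.
move=> m0 hM he k4.
set x0 := drift a m; set p1 := p m; set q := p m.+1.
have x00 : 0 <= x0 by exact: drift_ge0.
have p1m : (m <= p1)%N by exact: (p_ge pS).
have p10 : (0 < p1)%N by exact: leq_trans p1m.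
have ax0 : a * x0 <= p1%:R.
  by apply: le_trans (drift_le_lin a0 m) _; rewrite ler_nat.
have p1q : (p1 < q)%N by exact: pS.
have [_ hgap] := gap m; rewrite -/p1 -/q in hgap.
(* The number of indices from [- 4 * q] to [p1 - 1]; the cutoff [4 * q] meets the condition
   [4 * a * x0 <= K] of [poisson_bound]. *)
pose D := (4 * q + p1)%N.
pose b (j : nat) := f (x0 + (p1%:R - 1 - j%:R) / a).
pose P : {poly R[i]} := \poly_(j < D) b j.
have kD : (k < D)%N.
  apply: leq_trans k4 _; rewrite /D (leq_trans _ (leq_addr _ _))//.
  by rewrite leq_mul2l /= ltnW.
have PE z : P.[z] = \sum_(j < D) b j * z ^+ j by rewrite horner_poly.
have -> : f (x0 + (p1%:R - 1 - k%:R) / a) = P`_k by rewrite coef_poly kD.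
apply: hgap => // [x|t Kt].
  apply: le_trans hM; apply: le_trans (sample_sum_le D x00 ax0 p10).
  rewrite PE; apply: le_trans (normc_sum _ _ _) _; apply: ler_sum => j _.
  by rewrite normcM normcX normc_cis expr1n mulr1.
have q0 : (0 < q)%N by exact: leq_ltn_trans p1q.
apply: (@le_trans _ _ (64 * a ^+ 2 * C / q%:R)); last first.
  by rewrite ler_pM2r ?invr_gt0 ?ltr0n.
have q4 : (0 < q <= 4 * q)%N by rewrite q0 leq_pmull.
have aq : 4 * a * x0 <= (4 * q)%:R.
  rewrite natrM -mulrA ler_pM2l//; apply: le_trans ax0 _.
  by rewrite ler_nat ltnW.
have := @poisson_bound R u v a C a0 cu cv fC t (fourier0 Kt) x0 (4 * q) q x00 q4 aq.
apply: le_trans; rewrite le_eqVlt; apply/orP; left; apply/eqP.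
set G := fun i : nat => f (x0 + (i%:R - (4 * q)%:R) / a) *
  cis (- (t * (x0 + (i%:R - (4 * q)%:R) / a))).
transitivity (normc (\sum_(0 <= i < D) G i)); last first.
  congr normc; rewrite -(big_mkord xpredT G) [RHS](@big_cat_nat _ _ _ D)//=; last first.
    by rewrite leq_add2l ltnW.
  rewrite [X in _ = _ + X]big1_seq ?addr0// => i /andP[_].
  rewrite mem_index_iota => /andP[Di iq].
  have [n nE] : exists n, i = (4 * q + n)%N.
    by exists (i - 4 * q)%N; rewrite subnKC// (leq_trans (leq_addr _ _) Di).
  have npq : (p1 <= n < q)%N.
    by move: Di iq; rewrite nE /D leq_add2l ltn_add2l => -> ->.
  (* Inside block [m] the shift is [drift a m = x0], so the sample points in the gap are nodes. *)
  have xE : x0 + (i%:R - (4 * q)%:R) / a = node a p n%:Z.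
    rewrite node_nat (stageE p0 pS npq) nE natrD addrC; congr (_ / _ + _).
    by rewrite addrC addKr.
  have [u0 v0] := vanish n%:Z.
  rewrite /G xE /f u0 v0 -[Complex 0 0]/(0 : R[i]) mul0r//.
rewrite big_nat_rev big_mkord /= PE.
have -> : \sum_(i < D) G (0 + D - i.+1)%N =
   cis (- (t * (x0 + (p1%:R - 1) / a))) * \sum_(j < D) b j * cis (a^-1 * t) ^+ j.
  rewrite mulr_sumr; apply: eq_bigr => j _; rewrite /G /b.
  have -> : (0 + D - j.+1)%:R - (4 * q)%:R = p1%:R - 1 - j%:R :> R.
    rewrite add0n natrB// /D natrD -natr1; ring.
  rewrite mulrCA -cisMn -cisD; congr (_ * cis _).
  by field; exact: lt0r_neq0.
by rewrite normcM normc_cis mul1r.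
Qed.

(** By [drift_dense] some [drift m - k / a] with [m] large is close to [x]; there [f] is small by
    [sample_small], and continuity carries this to [x]. *)
Lemma vanish_everywhere (x : R) : u x = 0 /\ v x = 0.
Proof.
suff H (e : R) : 0 < e -> `|u x| <= e /\ `|v x| <= e.
  split; apply/eqP; rewrite -normr_le0; apply/ler_addgt0Pr => e e0; rewrite add0r.
    by have [] := H e e0.
  by have [] := H e e0.
move=> e0; have e2 : 0 < e / 2 by rewrite divr_gt0.
have [r r0 hr] : exists2 r : R, 0 < r & forall y, `|y - x| < r ->
    `|u x - u y| <= e / 2 /\ `|v x - v y| <= e / 2.
  have /cvgrPdist_le /(_ _ e2) := @cu x; rewrite nearE /= => /nbhs_ballP[r1 /= r10 h1].
  have /cvgrPdist_le /(_ _ e2) := @cv x; rewrite nearE /= => /nbhs_ballP[r2 /= r20 h2].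
  exists (Num.min r1 r2); first by rewrite lt_min r10.
  move=> y; rewrite lt_min distrC => /andP[y1 y2].
  by split; [exact: h1|exact: h2].
(* The sum of all lower bounds required of [p m]: for the two hypotheses of [sample_small], for
   [k <= 2 * p m], and for [1 / (p m + 1) <= e / 2]. *)
pose bnd := 5 * C + 32 * a ^+ 2 * C + 64 * a ^+ 2 * C + a * `|x| + 2 / e.
pose N := (Num.trunc bnd).+1.
have [m [k [Nm hmk]]] := drift_dense a0 x N r0.
have m0 : (0 < m)%N by exact: leq_trans Nm.
have p1m : (m <= p m)%N by exact: (p_ge pS).
have p10 : (0 < p m)%N by exact: leq_trans p1m.
have c1 : 0 <= 5 * C by rewrite mulr_ge0.
have c2 : 0 <= 32 * a ^+ 2 * C by rewrite !mulr_ge0// ltW.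
have c3 : 0 <= 64 * a ^+ 2 * C by rewrite !mulr_ge0// ltW.
have c4 : 0 <= a * `|x| by rewrite mulr_ge0// ltW.
have c5 : 0 < 2 / e by rewrite divr_gt0.
have pb : bnd <= (p m)%:R.
  apply: le_trans (ltW (truncnS_gt _)) _; rewrite ler_nat.
  exact: leq_trans p1m.
have p1R : 1 <= (p m)%:R :> R by rewrite ler1n.
have pp : (p m).+1%:R = (p m)%:R + 1 :> R by rewrite -natr1.
have hk : (k%:R : R) <= 2 * (p m)%:R.
  have am := drift_le_lin a0 m.
  have mp : m%:R <= (p m)%:R :> R by rewrite ler_nat.
  have kx : k%:R / a <= drift a m + `|x|.
    by have := ler_norm (- x); rewrite normrN; move/andP: hmk => [+ _]; lra.
  move: kx; rewrite ler_pdivrMr// mulrDl [_ * a]mulrC [`|x| * a]mulrC.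
  move: pb; rewrite /bnd; lra.
have k4 : ((p m).-1 + k < 4 * p m)%N.
  by apply: pred_add_lt => //; rewrite -(ler_nat R) natrM.
have yE : drift a m + ((p m)%:R - 1 - ((p m).-1 + k)%:R) / a = drift a m - k%:R / a.
  rewrite natrD -subn1 natrB//; ring.
have := @sample_small m ((p m).-1 + k)%N m0 _ _ k4; rewrite yE.
set y := drift a m - k%:R / a => hy.
have yx : `|y - x| < r.
  by rewrite ltr_norml /y; move: hmk; lra.
have fy : normc (f y) <= e / 2.
  apply: le_trans (hy _ _) _.
  - by rewrite pp; apply: lin_le_sqr => //; move: pb; rewrite /bnd; lra.
  - rewrite pp; move: pb; rewrite /bnd; lra.
  - rewrite invf_ple ?posrE// invf_div pp; move: pb; rewrite /bnd; lra.
have [ux vx] := hr y yx.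
have uy := le_trans (normc_Re (f y)) fy; have vy := le_trans (normc_Im (f y)) fy.
split.
  have -> : u x = (u x - u y) + u y by ring.
  by apply: le_trans (ler_normD _ _) _; rewrite [leRHS]splitr lerD.
have -> : v x = (v x - v y) + v y by ring.
by apply: le_trans (ler_normD _ _) _; rewrite [leRHS]splitr lerD.
Qed.

End Uniqueness.

Theorem theorem4 (R : realType) (S : set R) (a : R) :
  lebesgue_measurable S -> 0 < a -> (leb (Sa S a) < a%:E)%E ->
  exists L : set R, uniformly_discrete L /\ has_uniform_density L a /\
    uniqueness_set_YS S L.
Proof.
move=> _ a0 Sa_lt.
have [K [cK Ka K0 KS]] := compact_avoiding a0 Sa_lt.
have [nx hnx] := choice (exists_long_gap a0 cK Ka K0).
(* Each gap begins where the previous one ends. *)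
pose p m := iter m nx 0%N.
have gap m : long_gap a K (p m) (p m.+1) by exact: hnx.
have pS m : (p m < p m.+1)%N by have [] := gap m.
exists (range (node a p)); split; [|split].
- by apply: (lambda_uniformly_discrete a0) => n; apply: node_step.
- by apply: (lambda_density a0) => [n|eps e0]; [apply: node_step|apply: node_spread].
move=> u v [[cu [cv [C hC]]] hS] hL x.
apply: (@vanish_everywhere R a K p a0 erefl gap u v C cu cv).
- by move=> y; rewrite /= ler_pdivlMr ?ltr_wpDr ?sqr_ge0// mulrC.
(* If [t + k a] were in [S], then [t] would be in [Sa S a], which [K] avoids. *)
- move=> t Kt k; apply: hS => St; apply: (KS t Kt); split.
    by exists (- k); rewrite mulrNz mulNr opprK.
  by have := Ka t Kt; rewrite /= in_itv.
- by move=> n; apply: hL; exists n.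
Qed.
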